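(* Let $\Omega$ be a domain in $\mathbb{C}$, and let $\mathfrak{R}(\Omega)$ be the set of holomorphic functions $f$ in $\Omega$ with $\sup_\Omega|\Re f|\le1$. Assume that a point $\zeta\in\partial\Omega$ can be touched by an interior disk $D$. Then $$\limsup_{z\to\zeta}\ \sup_{f\in\mathfrak{R}(\Omega)}|z-\zeta|^s\,|f^{(s)}(z)|\le K_s,\qquad s=1,2,\dots,$$ where $z$ is a point on the radius of $D$ directed from the center of $D$ to $\zeta$, and $$K_s=\frac{s!}{\pi}\max_{\alpha\in\mathbb{R}}\int_{-\pi/2}^{\pi/2}\bigl|\cos\bigl(\alpha+(s+1)\varphi\bigr)\bigr|\cos^{s-1}\varphi\,d\varphi .$$ The constant $K_s$ cannot be diminished, i.e., for each $s$ it cannot be replaced by a smaller constant for which the inequality still holds for all such $\Omega$, $\zeta$, $D$.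
   Context: $\Re f$ denotes the real part of $f$. ''$\zeta\in\partial\Omega$ can be touched by an interior disk $D$'' means that there is an open disk $D\subset\Omega$ with $\zeta\in\partial D$. The limit is taken as $z$ tends to $\zeta$ along the segment joining the center of $D$ to $\zeta$. *)

(* Defs.v *)
From HB Require Import structures.
From mathcomp Require Import all_boot all_order all_algebra.
From mathcomp Require Import complex.
From mathcomp Require Import all_classical all_reals all_analysis.

Set Implicit Arguments.
Unset Strict Implicit.
Unset Printing Implicit Defensive.

Import Order.TTheory GRing.Theory Num.Theory numFieldNormedType.Exports.
Local Open Scope classical_set_scope.
Local Open Scope complex_scope.
Local Open Scope ring_scope.

(* R[i] itself carries no topology in the library; its regular algebra R[i]^o
   is a normed module over R[i], so that [open], [connected], [ball],
   [derivable] and [f^`(n)] below are those of the complex plane, the latter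
   two being complex differentiability and the n-th complex derivative. *)
Notation Cplane R := (complex R)^o (only parsing).

Definition domain (R : realType) (Omega : set (Cplane R)) : Prop :=
  [/\ open Omega, connected Omega & Omega !=set0].

Definition bdry (R : realType) (A : set (Cplane R)) : set (Cplane R) :=
  closure A `\` A°.

Definition holomorphic (R : realType) (Omega : set (Cplane R))
    (f : Cplane R -> Cplane R) : Prop :=
  forall z, Omega z -> derivable f z 1.

(* Functions are total on the complex plane; only their values on the open set
   Omega matter for the class and for the derivatives at points of Omega. *)
Definition realpart_unit_class (R : realType) (Omega : set (Cplane R))
    : set (Cplane R -> Cplane R) :=
  [set f | holomorphic Omega f /\
    (ereal_sup [set `|complex.Re (f z)|%:E | z in Omega] <= 1%:E)%E].

Definition disk (R : realType) (c : Cplane R) (r : R) : set (Cplane R) :=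
  ball c r%:C.

Definition touched_by_disk (R : realType) (Omega : set (Cplane R))
    (zeta c : Cplane R) (r : R) : Prop :=
  [/\ 0 < r, disk c r `<=` Omega & bdry (disk c r) zeta].

(* The segment from c to zeta, without the endpoint zeta. *)
Definition radius_to (R : realType) (c zeta : Cplane R) : set (Cplane R) :=
  [set c + t%:C * (zeta - c) | t in `[0, 1[%classic].

(* [Normc.normc] is the R-valued modulus. *)
Definition weighted_sup (R : realType) (Omega : set (Cplane R))
    (zeta : Cplane R) (s : nat) (z : Cplane R) : \bar R :=
  ereal_sup
    [set (Normc.normc (z - zeta) ^+ s * Normc.normc ((f^`(s))%classic z))%:E
    | f in realpart_unit_class Omega].

Definition radial_limsup (R : realType) (Omega : set (Cplane R))
    (zeta c : Cplane R) (s : nat) : \bar R :=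
  limf_esup (weighted_sup Omega zeta s)
    (within (radius_to c zeta) (nbhs zeta)).

Definition radial_bound (R : realType) (s : nat) (k : R) : Prop :=
  forall (Omega : set (Cplane R)) (zeta c : Cplane R) (r : R),
    domain Omega -> bdry Omega zeta -> touched_by_disk Omega zeta c r ->
    (radial_limsup Omega zeta c s <= k%:E)%E.

Definition cos_integral (R : realType) (s : nat) (alpha : R) : R :=
  \int[lebesgue_measure]_(phi in `[- (pi / 2), pi / 2])
    (`|cos (alpha + s.+1%:R * phi)| * cos phi ^+ s.-1).

(* The supremum over alpha is a maximum: the theorem asserts its attainment. *)
Definition K_ (R : realType) (s : nat) : R :=
  s`!%:R / pi * sup [set cos_integral s alpha | alpha in [set: R]].

(* Main.v *)
Require Import Defs.
From HB Require Import structures.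
From mathcomp Require Import all_boot all_order all_algebra.
From mathcomp Require Import complex.
From mathcomp Require Import all_classical all_reals all_analysis.
From mathcomp Require Import ring lra.

Set Implicit Arguments.
Unset Strict Implicit.
Unset Printing Implicit Defensive.

Import Order.TTheory GRing.Theory Num.Theory numFieldNormedType.Exports.
Local Open Scope classical_set_scope.
Local Open Scope complex_scope.
Local Open Scope ring_scope.

(** Upper bound. After a dilation the claim concerns a holomorphic [f] with
    [|Re f| <= 1] in a disc slightly larger than the unit disc, and its n-th
    derivative at a real point [p] of the unit disc. Cauchy's formula expresses
    [f^(n)(p)] by the integral of [f(w) / (w - p)^(n+1)] over the unit circle. The
    same integral with the conjugate of [f] vanishes for [n >= 1]: as
    [conj w = 1 / w] on the circle, it is up to sign the conjugate of the integral
    of the holomorphic function [f(w) w^(n-1) / (1 - p w)^(n+1)]. Adding the two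
    integrals leaves only [Re f]:
    [f^(n)(p) = n! / (pi i) * int Re f(w) dw / (w - p)^(n+1)].
    The circle is now parametrized by an angle [x] in [[-pi/2, pi/2]] as seen from
    [p]: with [eps = (1 - p) / (1 + p)] and [q = cos x - i eps sin x], the point
    [w = conj q / q] satisfies [w - p = (1 - p) e^(ix) / q], and the kernel becomes
    exactly [(1 - p)^(-n) i (1 + eps) q^(n-1) e^(-i(n+1)x) dx] ([angle_kernel]).
    Since [q^(n-1)] is within [(n-1) eps] of [cos^(n-1) x], this bounds
    [(1 - p)^n |f^(n)(p)|] by the constant of the theorem plus a multiple of [eps],
    for all [f] at once ([cauchy_deriv_bound], [radius_bound]); [eps] tends to 0 as
    [p] tends to 1.

    Sharpness. In the right half-plane no error term occurs: the Schwarz integral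
    of the boundary values [sign cos (alpha + (n+1) atan y)] would attain the bound
    at the point 1. Replacing the sign by a continuous ramp and cutting the
    integral off at a finite height loses arbitrarily little ([extremal_deriv_ge]),
    keeps [|Re f| <= 1] because the Poisson kernel has mass at most 1
    ([extremal_Re]), and dilations move the function to every point of the radius.

    Cauchy's formula is derived from Goursat's lemma for triangles, which gives
    primitives in discs. If [F] is a primitive of a holomorphic function, then
    [(F w - F a) / (w - a)] is holomorphic at [a] too ([quotient_holo]), since [F]
    is twice differentiable; its integral over a closed curve therefore vanishes,
    which is Cauchy's formula for [F]. Differentiating it under the integral sign
    shows that [F], hence any holomorphic function, is infinitely differentiable,
    and then the formula holds for every holomorphic function.

    That the maximum over [alpha] is attained follows from the Lipschitz continuity
    and the periodicity of [cos_integral] ([cos_integral_max]). *)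

(** * The complex plane through its real-valued modulus *)

Section Modulus.
Variable R : realType.
Implicit Types (x y : R) (z w : Cplane R).
Local Notation normc := (@Normc.normc R).

Lemma normcE z : `|z| = (normc z)%:C. Proof. by []. Qed.

Lemma normc_ge0 z : 0 <= normc z.
Proof. by rewrite -ler0c -normcE. Qed.

Lemma normcB z w : normc (z - w) = normc (w - z).
Proof. by apply: (@complexI R); rewrite -!normcE distrC. Qed.

Lemma normc_real x : normc x%:C = `|x|.
Proof. by apply: (@complexI R); rewrite -normcE normc_def /= expr0n addr0 sqrtr_sqr. Qed.

Lemma normcX z n : normc (z ^+ n) = normc z ^+ n.
Proof.
by elim: n => [|n IH]; rewrite ?expr0 ?Normc.normc1// !exprS Normc.normcM IH.
Qed.

Lemma normc_gt0 z : (0 < normc z) = (z != 0).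
Proof. by rewrite -ltcR -normcE normr_gt0. Qed.

Lemma ler_normcD z w : normc (z + w) <= normc z + normc w.
Proof. exact: le_normcD. Qed.

Lemma ler_normcB z w : normc (z - w) <= normc z + normc w.
Proof. by rewrite (le_trans (ler_normcD _ _))// normcN. Qed.

Lemma normc_Re z : `|complex.Re z| <= normc z.
Proof. by rewrite -lecR -normcE normc_ge_Re. Qed.

Lemma normc_Im z : `|complex.Im z| <= normc z.
Proof.
case: z => a b; have := normc_Re ((b +i* a) : Cplane R).
by rewrite /Normc.normc /= addrC.
Qed.

Lemma normc_le_ReIm z : normc z <= `|complex.Re z| + `|complex.Im z|.
Proof.
rewrite [z in normc z]complexE (le_trans (ler_normcD _ _))//.
by rewrite Normc.normcM !normc_real /Normc.normc /= expr0n expr1n add0r sqrtr1 mul1r.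
Qed.

(** A positive element of [R[i]] is real, so balls of real radius suffice. *)
Lemma nbhs_normcP z (P : set (Cplane R)) :
  nbhs z P <-> exists2 d : R, 0 < d & forall w, normc (w - z) < d -> P w.
Proof.
split=> [/nbhs_ballP[e /= e0 zP]|[d d0 zP]].
  have eR : e = (complex.Re e)%:C.
    by move: e0; rewrite ltcE /= => /andP[/eqP + _]; case: (e) => a b /= ->.
  exists (complex.Re e); first by rewrite -ltcR -eR.
  move=> w wz; apply: zP; rewrite /ball/= normcB in wz *.
  by rewrite /ball_/= eR normcE ltcR.
apply/nbhs_ballP; exists d%:C => /=; first by rewrite ltcR.
move=> w; rewrite /ball/= /ball_/= normcE ltcR => ?; apply: zP.
by rewrite normcB.
Qed.

Lemma continuous_normcP (T : topologicalType) (f : T -> Cplane R) (t : T) :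
  {for t, continuous f} <->
  forall e : R, 0 < e -> \forall u \near t, normc (f u - f t) < e.
Proof.
split=> [cf e e0|cf].
  by apply: (cf [set w | normc (w - f t) < e]); apply/nbhs_normcP; exists e.
move=> P /nbhs_normcP[e e0 fP]; have := cf e e0.
by apply: filterS => u; exact: fP.
Qed.

Lemma continuous_complexP (T : topologicalType) (f : T -> Cplane R) (t : T) :
  {for t, continuous f} <->
  {for t, continuous (fun u => complex.Re (f u))} /\
  {for t, continuous (fun u => complex.Im (f u))}.
Proof.
split=> [/continuous_normcP cf|[cr ci]].
  split; apply/cvgrPdist_lt => e e0; have := cf e e0; apply: filterS => u fe;
    rewrite distrC -raddfB (le_lt_trans _ fe)//.
  - exact: normc_Re.
  - exact: normc_Im.
apply/continuous_normcP => e e0.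
have e20 : 0 < e / 2 by rewrite divr_gt0.
move/cvgrPdist_lt: cr => /(_ _ e20) cr; move/cvgrPdist_lt: ci => /(_ _ e20) ci.
near=> u; rewrite (le_lt_trans (normc_le_ReIm _))// (splitr e) ltrD// raddfB distrC.
- by near: u; exact: cr.
- by near: u; exact: ci.
Unshelve. all: by end_near. Qed.

Lemma continuous_real (T : topologicalType) (f : T -> R) (t : T) :
  {for t, continuous f} -> {for t, continuous (fun u => (f u)%:C : Cplane R)}.
Proof. by move=> cf; apply/continuous_complexP; split => //=; exact: cvg_cst. Qed.

Lemma ler_dist_normc z w : `|normc z - normc w| <= normc (z - w).
Proof.
rewrite -lecR -normcE -normc_real -normcE rmorphB /= -!normcE.
exact: ler_dist_dist.
Qed.

Lemma continuous_normc (T : topologicalType) (f : T -> Cplane R) (t : T) :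
  {for t, continuous f} -> {for t, continuous (fun u => normc (f u))}.
Proof.
move=> /continuous_normcP cf; apply/cvgrPdist_lt => e e0; have := cf e e0; apply: filterS => u fe.
by rewrite distrC (le_lt_trans (ler_dist_normc _ _)).
Qed.

Lemma continuous_conj (T : topologicalType) (f : T -> Cplane R) (t : T) :
  {for t, continuous f} -> {for t, continuous (fun u => (f u)^* : Cplane R)}.
Proof.
move=> /continuous_complexP[cr ci]; apply/continuous_complexP; split.
  rewrite (_ : (fun u => _) = (fun u => complex.Re (f u)))//.
  by apply/funext => u; case: (f u).
rewrite (_ : (fun u => _) = (fun u => - complex.Im (f u))); first exact: cvgN.
by apply/funext => u; case: (f u).
Qed.
End Modulus.

Section ContinuityRules.
Variables (R : realType) (T : topologicalType).
Implicit Types (f g : T -> Cplane R) (x : T).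

Lemma ccst_continuous (c : Cplane R) x : {for x, continuous (fun=> c : Cplane R)}.
Proof. exact: cst_continuous. Qed.

Lemma cadd_continuous f g x : {for x, continuous f} -> {for x, continuous g} ->
  {for x, continuous (fun y => f y + g y)}.
Proof. by move=> cf cg; exact: (cvgD cf cg). Qed.

Lemma copp_continuous f x : {for x, continuous f} ->
  {for x, continuous (fun y => - f y)}.
Proof. by move=> cf; exact: (cvgN cf). Qed.

Lemma csub_continuous f g x : {for x, continuous f} -> {for x, continuous g} ->
  {for x, continuous (fun y => f y - g y)}.
Proof. by move=> cf cg; exact: (cvgB cf cg). Qed.

Lemma cmul_continuous f g x : {for x, continuous f} -> {for x, continuous g} ->
  {for x, continuous (fun y => f y * g y)}.
Proof. by move=> cf cg; exact: (cvgM cf cg). Qed.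

Lemma cinv_continuous f x : f x != 0 -> {for x, continuous f} ->
  {for x, continuous (fun y => (f y)^-1)}.
Proof. by move=> fx0 cf; exact: (cvgV fx0 cf). Qed.

Lemma cexp_continuous f n x : {for x, continuous f} ->
  {for x, continuous (fun y => f y ^+ n)}.
Proof.
move=> cf; elim: n => [|n IH]; first exact: ccst_continuous.
rewrite (_ : (fun y => _) = (fun y => f y * f y ^+ n)).
  exact: cmul_continuous.
by apply/funext => y; rewrite exprS.
Qed.
End ContinuityRules.
Arguments ccst_continuous {R T} c x.
Arguments nbhs_normcP {R} z P.

Lemma nbhs_normcI (R : realType) (z : Cplane R) (P Q : set (Cplane R)) :
  nbhs z P -> nbhs z Q ->
  exists2 d : R, 0 < d & forall w, Normc.normc (w - z) < d -> P w /\ Q w.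
Proof. by move=> zP zQ; apply/nbhs_normcP; exact: filterI. Qed.

Section ReIm.
Variable R : realType.
Implicit Types (z w : Cplane R) (x : R).
Lemma cReD z w : complex.Re (z + w) = complex.Re z + complex.Re w.
Proof. by case: z w => a b [c d]. Qed.
Lemma cImD z w : complex.Im (z + w) = complex.Im z + complex.Im w.
Proof. by case: z w => a b [c d]. Qed.
Lemma cReN z : complex.Re (- z) = - complex.Re z.
Proof. by case: z. Qed.
Lemma cImN z : complex.Im (- z) = - complex.Im z.
Proof. by case: z. Qed.
Lemma cReM z w : complex.Re (z * w) =
  complex.Re z * complex.Re w - complex.Im z * complex.Im w.
Proof. by case: z w => a b [c d]. Qed.
Lemma cImM z w : complex.Im (z * w) =
  complex.Re z * complex.Im w + complex.Im z * complex.Re w.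
Proof. by case: z w => a b [c d]. Qed.
End ReIm.

(** * Derivatives through slope functions *)

(** Caratheodory's form of differentiability of [f] with respect to [iota]: the
    slope [q] is continuous at [x], which turns each differentiation rule into a
    continuity rule. With [iota] the identity of the plane this is complex
    differentiability, with the inclusion of the reals it is differentiability of
    a curve, and one set of rules serves both. *)
Definition has_deriv (R : realType) (T : topologicalType)
    (iota f : T -> Cplane R) (x : T) (d : Cplane R) : Prop :=
  exists q : T -> Cplane R, [/\ q x = d, {for x, continuous q} &
    \forall y \near x, f y - f x = q y * (iota y - iota x)].

Notation cderiv f z d := (has_deriv id f z d).
Notation rderiv R g x d := (has_deriv (@real_complex_def R (Phant R)) g x d).

Section DerivRules.
Variables (R : realType) (T : topologicalType) (iota : T -> Cplane R).
Implicit Types (f g : T -> Cplane R) (x : T) (c d e : Cplane R).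

Lemma has_deriv_slope (q : T -> Cplane R) f x :
  {for x, continuous q} -> (forall y, f y - f x = q y * (iota y - iota x)) ->
  has_deriv iota f x (q x).
Proof. by move=> cq fq; exists q; split => //; exact: nearW. Qed.

Lemma has_deriv_cst c x : has_deriv iota (fun=> c) x 0.
Proof.
exists (fun=> 0); split => //; first exact: ccst_continuous.
by apply: nearW => y; rewrite subrr mul0r.
Qed.

Lemma has_deriv_iota x : has_deriv iota iota x 1.
Proof.
exists (fun=> 1); split => //; first exact: ccst_continuous.
by apply: nearW => y; rewrite mul1r.
Qed.

Lemma has_deriv_near f g x d : (\forall y \near x, f y = g y) ->
  has_deriv iota f x d -> has_deriv iota g x d.
Proof.
move=> fg [q [qx cq fq]]; exists q; split => //.
have fgx := nbhs_singleton fg.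
by apply: filterS2 fg fq => y fgy; rewrite fgy fgx.
Qed.

Lemma has_deriv_ext f g x d : f =1 g ->
  has_deriv iota f x d -> has_deriv iota g x d.
Proof. by move=> fg; apply: has_deriv_near; exact: nearW. Qed.

Lemma has_derivD f g x d e : has_deriv iota f x d -> has_deriv iota g x e ->
  has_deriv iota (fun y => f y + g y) x (d + e).
Proof.
move=> [p [px cp fp]] [q [qx cq gq]]; exists (fun y => p y + q y); split.
- by rewrite px qx.
- exact: cadd_continuous.
- by apply: filterS2 fp gq => y fy gy; rewrite mulrDl -fy -gy; ring.
Qed.

Lemma has_derivN f x d : has_deriv iota f x d ->
  has_deriv iota (fun y => - f y) x (- d).
Proof.
move=> [p [px cp fp]]; exists (fun y => - p y); split.
- by rewrite px.
- exact: copp_continuous.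
- by apply: filterS fp => y fy; rewrite mulNr -fy; ring.
Qed.

Lemma has_derivB f g x d e : has_deriv iota f x d -> has_deriv iota g x e ->
  has_deriv iota (fun y => f y - g y) x (d - e).
Proof. by move=> fd /has_derivN; exact: has_derivD. Qed.

Hypothesis ciota : continuous iota.

Lemma has_deriv_continuous f x d : has_deriv iota f x d ->
  {for x, continuous f}.
Proof.
move=> [q [qx cq fq]].
have cF : {for x, continuous (fun y => f x + q y * (iota y - iota x))}.
  apply: cadd_continuous; first exact: ccst_continuous.
  apply: cmul_continuous; first exact: cq.
  apply: csub_continuous; [exact: ciota|exact: ccst_continuous].
rewrite /prop_for /continuous_at in cF *.
rewrite subrr mulr0 addr0 in cF.
apply: cvg_trans cF; apply: near_eq_cvg.
by apply: filterS fq => y <-; rewrite addrC subrK.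
Qed.

Lemma has_derivM f g x d e : has_deriv iota f x d -> has_deriv iota g x e ->
  has_deriv iota (fun y => f y * g y) x (d * g x + f x * e).
Proof.
move=> fd ge; have cg := has_deriv_continuous ge.
move: fd ge => [p [px cp fp]] [q [qx cq gq]].
exists (fun y => p y * g y + f x * q y); split.
- by rewrite px qx.
- exact: (cadd_continuous (cmul_continuous cp cg) (cmul_continuous (ccst_continuous (f x) x) cq)).
- apply: filterS2 fp gq => y fy gy.
  by rewrite mulrDl mulrAC -fy -mulrA -gy; ring.
Qed.

Lemma has_derivMl c f x d : has_deriv iota f x d ->
  has_deriv iota (fun y => c * f y) x (c * d).
Proof.
move=> fd; have := has_derivM (has_deriv_cst c x) fd.
by rewrite mul0r add0r.
Qed.

Lemma has_derivX f n x d : has_deriv iota f x d ->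
  has_deriv iota (fun y => f y ^+ n) x (n%:R * f x ^+ n.-1 * d).
Proof.
move=> fd; elim: n => [|n IH]; first by rewrite !mul0r; exact: has_deriv_cst.
have := has_derivM fd IH.
rewrite [X in has_deriv _ _ _ X](_ : _ = n.+1%:R * f x ^+ n.+1.-1 * d).
  by apply: has_deriv_ext => y; rewrite exprS.
case: n {IH} => [|n] /=; first by rewrite !expr0; ring.
by rewrite exprS -[n.+2%:R]natr1; ring.
Qed.

Lemma has_derivV f x d : has_deriv iota f x d -> f x != 0 ->
  has_deriv iota (fun y => (f y)^-1) x (- d / f x ^+ 2).
Proof.
move=> fd fx0; have cf := has_deriv_continuous fd.
move: fd => [p [px cp fp]].
exists (fun y => - p y / (f y * f x)); split.
- by rewrite px expr2.
- apply: (cmul_continuous (copp_continuous cp)).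
  apply: cinv_continuous; first by rewrite mulf_neq0.
  exact: (cmul_continuous cf (ccst_continuous (f x) x)).
have f0 : \forall y \near x, f y != 0.
  have := cf [set w | w != 0]; apply.
  by apply/nbhs_normcP; exists (Normc.normc (f x)); rewrite ?normc_gt0// => w;
    apply: contraPneq => ->; rewrite sub0r normcN ltxx.
apply: filterS2 fp f0 => y fy fy0.
rewrite mulrAC mulNr -fy; field.
by rewrite fx0.
Qed.

(** The intermediate space is arbitrary, so this covers reparametrizing a curve
    as well as composing it with a holomorphic function. *)
Lemma has_deriv_chain (T' : topologicalType) (iota' F : T' -> Cplane R)
    (g : T -> T') x d e : {for x, continuous g} ->
  has_deriv iota' F (g x) e -> has_deriv iota (fun y => iota' (g y)) x d ->
  has_deriv iota (fun y => F (g y)) x (e * d).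
Proof.
move=> cg [Q [Qx cQ FQ]] [q [qx cq gq]].
exists (fun y => Q (g y) * q y); split.
- by rewrite Qx qx.
- exact: (cmul_continuous (cvg_comp _ _ cg cQ) cq).
have FQg : \forall y \near x,
    F (g y) - F (g x) = Q (g y) * (iota' (g y) - iota' (g x)) := cg _ FQ.
by apply: filterS2 FQg gq => y Fy gy; rewrite Fy gy mulrA.
Qed.

Lemma has_deriv_comp (F : Cplane R -> Cplane R) f x d e :
  cderiv F (f x) e -> has_deriv iota f x d ->
  has_deriv iota (fun y => F (f y)) x (e * d).
Proof.
by move=> Fe fd; apply: has_deriv_chain (has_deriv_continuous fd) Fe fd.
Qed.
End DerivRules.

Section PlaneDeriv.
Variable R : realType.
Implicit Types (f g : Cplane R -> Cplane R) (z w d : Cplane R).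
Local Notation normc := (@Normc.normc R).

Lemma cid_continuous : continuous (id : Cplane R -> Cplane R).
Proof. by move=> z. Qed.

Lemma creal_continuous : continuous (real_complex R : R -> Cplane R).
Proof. by move=> x; apply: (@continuous_real _ R id). Qed.

Lemma cderivP f z d : cderiv f z d <->
  forall e : R, 0 < e -> exists2 r : R, 0 < r &
    forall w, normc (w - z) < r ->
      normc (f w - f z - d * (w - z)) <= e * normc (w - z).
Proof.
split=> [[q [<- cq fq]] e e0|fd].
  move: cq => /continuous_normcP/(_ e e0) cq.
  have [r r0 H] := nbhs_normcI cq fq; exists r => // w wz.
  have [/= qe ->] := H w wz.
  by rewrite -mulrBl Normc.normcM ler_wpM2r ?normc_ge0 ?ltW.
pose q w := if w == z then d else (f w - f z) / (w - z).
rewrite (_ : d = q z); last by rewrite /q eqxx.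
apply: has_deriv_slope.
  apply/continuous_normcP => e e0.
  have [|r r0 H] := fd (e / 2); first by rewrite divr_gt0.
  apply/nbhs_normcP; exists r => // w wz; rewrite /q eqxx.
  case: eqVneq => [_|wNz]; first by rewrite subrr Normc.normc0.
  have wz0 : w - z != 0 by rewrite subr_eq0.
  rewrite (_ : _ - d = (f w - f z - d * (w - z)) / (w - z)); last by field.
  rewrite Normc.normcM Normc.normcV ltr_pdivrMr ?normc_gt0//.
  rewrite (le_lt_trans (H w wz))// ltr_pM2r ?normc_gt0//.
  by rewrite ltr_pdivrMr// ltr_pMr// ltr1n.
move=> w; rewrite /q; case: eqVneq => [->|wz]; first by rewrite !subrr mulr0.
by rewrite divfK// subr_eq0.
Qed.

Lemma cderiv_quadratic f z d (M r : R) : 0 < r ->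
  (forall w, normc (w - z) < r ->
     normc (f w - f z - d * (w - z)) <= M * normc (w - z) ^+ 2) ->
  cderiv f z d.
Proof.
move=> r0 H; apply/cderivP => e e0.
have M0 : 0 < `|M| + 1 by rewrite ltr_wpDl.
exists (Num.min r (e / (`|M| + 1))); first by rewrite lt_min r0 divr_gt0.
move=> w; rewrite lt_min => /andP[wr we]; apply: le_trans (H w wr) _.
rewrite expr2 mulrA ler_wpM2r ?normc_ge0//.
rewrite (@le_trans _ _ ((`|M| + 1) * normc (w - z)))//.
  by rewrite ler_wpM2r ?normc_ge0// (le_trans (ler_norm M))// lerDl.
by rewrite mulrC -ler_pdivlMr// ltW.
Qed.

Lemma is_derive_cderiv f z d : is_derive z (1 : Cplane R) f d -> cderiv f z d.
Proof.
move=> fd.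
pose q w := if w == z then d else (f w - f z) / (w - z).
rewrite (_ : d = q z); last by rewrite /q eqxx.
apply: has_deriv_slope.
  have [/cvg_ex[l /= lP] df] := fd.
  have ld : l = d by rewrite -df /derive; apply/esym/cvg_lim.
  apply/continuous_normcP => e e0; subst l.
  have /lP : nbhs d [set u | normc (u - d) < e] by apply/nbhs_normcP; exists e.
  rewrite /= /dnbhs /within/= => /nbhs_normcP[r r0 H].
  apply/nbhs_normcP; exists r => // w wz; rewrite /q eqxx.
  case: eqVneq => [_|wNz]; first by rewrite subrr Normc.normc0.
  have wz0 : w - z != 0 by rewrite subr_eq0.
  have := H (w - z); rewrite subr0 => /(_ wz wz0).
  by rewrite /= scaler1 subrK /GRing.scale/= mulrC.
move=> w; rewrite /q; case: eqVneq => [->|wz]; first by rewrite !subrr mulr0.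
by rewrite divfK// subr_eq0.
Qed.

Lemma cderiv_is_derive f z d : cderiv f z d -> is_derive z (1 : Cplane R) f d.
Proof.
move=> /cderivP H.
have lP : (fun h : Cplane R => h^-1 *: ((f \o shift z) (h *: (1 : Cplane R)) - f z))
    @ (0 : Cplane R)^' --> d.
  move=> P /nbhs_normcP[e e0 eP].
  have [|r r0 K] := H (e / 2); first by rewrite divr_gt0.
  rewrite /= /dnbhs /within/=; apply/nbhs_normcP; exists r => // h hr h0.
  apply: eP => /=; rewrite scaler1.
  rewrite subr0 in hr; have := K (h + z); rewrite addrK => /(_ hr) {}K.
  rewrite (_ : _ - d = (f (h + z) - f z - d * h) / h); last first.
    by rewrite /GRing.scale/=; field.
  rewrite Normc.normcM Normc.normcV ltr_pdivrMr ?normc_gt0//.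
  rewrite (le_lt_trans K)// ltr_pM2r ?normc_gt0//.
  by rewrite ltr_pdivrMr// ltr_pMr// ltr1n.
split; first by apply/cvg_ex; exists d.
exact/cvg_lim.
Qed.

Lemma cderiv_unique f z d e : cderiv f z d -> cderiv f z e -> d = e.
Proof.
move=> /cderiv_is_derive[_ <-] /cderiv_is_derive[_ <-].
by [].
Qed.
End PlaneDeriv.

Section CurveDeriv.
Variable R : realType.
Implicit Types (g : R -> Cplane R) (x : R) (d : Cplane R).

Lemma rderiv_real (h : R -> R) x (d : R) : is_derive x (1 : R) h d ->
  rderiv R (fun y => (h y)%:C : Cplane R) x d%:C.
Proof.
move=> hd.
pose q y := if y == x then d else (h y - h x) / (y - x).
rewrite (_ : d%:C = (q x)%:C); last by rewrite /q eqxx.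
apply: (has_deriv_slope (q := fun y => (q y)%:C)).
  have [/cvg_ex[l /= lP] df] := hd.
  have ld : l = d by rewrite -df /derive; apply/esym/cvg_lim.
  apply: continuous_real; apply/cvgrPdist_lt => e e0; subst l.
  move/cvgrPdist_lt : lP => /(_ e e0).
  rewrite /= /dnbhs /within/= => /nbhs_ballP[r /= r0 H].
  apply/nbhs_ballP; exists r => // y; rewrite /ball/= distrC => yx.
  rewrite /q eqxx; case: eqVneq => [_|yNx]; first by rewrite subrr normr0.
  have := H (y - x); rewrite /ball/= sub0r normrN => /(_ yx).
  rewrite subr_eq0 => /(_ yNx).
  by rewrite /= scaler1 subrK /GRing.scale/= mulrC.
move=> y; rewrite /q -!rmorphB -rmorphM /=; congr (_ %:C).
case: eqVneq => [->|yx]; first by rewrite !subrr mulr0.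
by rewrite divfK// subr_eq0.
Qed.

Lemma rderiv_ReIm g x d : rderiv R g x d ->
  is_derive x (1 : R) (fun y => complex.Re (g y)) (complex.Re d) /\
  is_derive x (1 : R) (fun y => complex.Im (g y)) (complex.Im d).
Proof.
move=> [q [<- /continuous_complexP[cr ci] gq]].
suff H (p h : R -> R) : {for x, continuous p} ->
    (\forall y \near x, h y - h x = p y * (y - x)) ->
    is_derive x (1 : R) h (p x).
  split.
    apply: (H (fun y => complex.Re (q y)) (fun y => complex.Re (g y))) => //.
    apply: filterS gq => y /(congr1 (@complex.Re R)).
    by rewrite cReM cReD cReN -rmorphB/= mulr0 subr0.
  apply: (H (fun y => complex.Im (q y)) (fun y => complex.Im (g y))) => //.
  apply: filterS gq => y /(congr1 (@complex.Im R)).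
  by rewrite cImM cImD cImN -rmorphB/= mulr0 add0r.
move=> cp hp.
have lP : t^-1 *: ((h \o shift x) (t *: (1 : R)) - h x) @[t --> 0^'] --> p x.
  apply/cvgrPdist_lt => e e0.
  move/cvgrPdist_lt : cp => /(_ e e0) cp.
  have [r /= r0 H] := (nbhs_ballP x _).1 (@filterI _ (nbhs x) _ _ _ cp hp).
  rewrite /= /dnbhs /within/=; apply/nbhs_ballP; exists r => // t.
  rewrite /ball/= sub0r normrN => tr t0.
  have := H (t + x); rewrite /ball/= opprD addrCA subrr addr0 normrN => /(_ tr)[/= H1 H2].
  rewrite scaler1 H2 addrK /GRing.scale/= mulrC mulfK//.
split; first by apply/cvg_ex; exists (p x).
exact/cvg_lim.
Qed.
End CurveDeriv.

(** * Integrals of complex functions of a real variable *)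

Section RealIntegral.
Variable R : realType.
Implicit Types (f F : R -> R) (a b x : R).
Local Notation mu := (@lebesgue_measure R).

Lemma continuous_integrable f a b : continuous f ->
  mu.-integrable `[a, b] (EFin \o f).
Proof.
move=> cf; apply: continuous_compact_integrable; first exact: segment_compact.
exact: continuous_subspaceT.
Qed.

Lemma Rintegral_FTC2 f F a b : a < b -> continuous f ->
  (forall x, a <= x <= b -> is_derive x (1 : R) F (f x)) ->
  \int[mu]_(x in `[a, b]) f x = F b - F a.
Proof.
move=> ab cf dF; rewrite /Rintegral (@continuous_FTC2 _ f F)//.
- exact: continuous_subspaceT.
- have cF x : a <= x <= b -> {for x, continuous F}.
    move=> xab; have [dFx _] := dF x xab.
    by apply/differentiable_continuous/derivable1_diffP.
  split.
  + by move=> x; rewrite in_itv/= => /andP[ax xb]; have [] := dF x; rewrite ?ltW.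
  + by apply: cvg_at_right_filter; apply: cF; rewrite lexx ltW.
  + by apply: cvg_at_left_filter; apply: cF; rewrite lexx ltW.
- move=> x; rewrite in_itv/= => /andP[ax xb]; rewrite derive1E.
  by have [] := dF x; rewrite ?ltW.
Qed.

Lemma Rintegral_FTC1 f a x : continuous f -> a < x ->
  is_derive x (1 : R) (fun y => \int[mu]_(t in `[a, y]) f t) (f x).
Proof.
move=> cf ax.
have x1 : x < x + 1 by rewrite ltrDl.
have [dF FE] :=
  @continuous_FTC1_closed R f a x _ x1 (continuous_integrable a _ cf) ax (cf x).
by apply: DeriveDef; [exact: dF|rewrite -derive1E; exact: FE].
Qed.

Lemma Rintegral_le f g a b : continuous f -> continuous g ->
  (forall x, a <= x <= b -> f x <= g x) ->
  \int[mu]_(x in `[a, b]) f x <= \int[mu]_(x in `[a, b]) g x.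
Proof.
move=> cf cg fg; apply: le_Rintegral => //; try exact: continuous_integrable.
Qed.

Lemma Rintegral_const a b (r : R) : a <= b ->
  \int[mu]_(x in `[a, b]) r = r * (b - a).
Proof.
move=> ab; rewrite Rintegral_cst//= lebesgue_measure_itv/= lte_fin.
by move: ab; rewrite le_eqVlt => /predU1P[->|->]//=; rewrite ltxx subrr.
Qed.
End RealIntegral.

Definition cint (R : realType) (a b : R) (h : R -> Cplane R) : Cplane R :=
  (\int[lebesgue_measure]_(x in `[a, b]) complex.Re (h x)) +i*
  (\int[lebesgue_measure]_(x in `[a, b]) complex.Im (h x)).

Section ComplexIntegral.
Variable R : realType.
Implicit Types (h k : R -> Cplane R) (a b x : R).
Local Notation mu := (@lebesgue_measure R).
Local Notation normc := (@Normc.normc R).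

Lemma continuous_Re h : continuous h -> continuous (fun x => complex.Re (h x)).
Proof. by move=> ch x; have /continuous_complexP[] := ch x. Qed.

Lemma continuous_Im h : continuous h -> continuous (fun x => complex.Im (h x)).
Proof. by move=> ch x; have /continuous_complexP[] := ch x. Qed.

Let integrable_Re h a b : continuous h ->
  mu.-integrable `[a, b] (EFin \o (fun x => complex.Re (h x))).
Proof. by move=> /continuous_Re; exact: continuous_integrable. Qed.

Let integrable_Im h a b : continuous h ->
  mu.-integrable `[a, b] (EFin \o (fun x => complex.Im (h x))).
Proof. by move=> /continuous_Im; exact: continuous_integrable. Qed.

Lemma eq_cint h k a b : (forall x, a <= x <= b -> h x = k x) ->
  cint a b h = cint a b k.
Proof.
move=> hk; congr (_ +i* _); apply: eq_Rintegral => x;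
  by rewrite inE/= in_itv/= => xab; rewrite hk.
Qed.

Lemma cintD h k a b : continuous h -> continuous k ->
  cint a b (fun x => h x + k x) = cint a b h + cint a b k.
Proof.
move=> ch ck; apply/eqP; rewrite eq_complex cReD cImD /=; apply/andP; split.
- rewrite -RintegralD//; last 2 first. exact: integrable_Re. exact: integrable_Re.
  by apply/eqP/eq_Rintegral => x _; rewrite cReD.
- rewrite -RintegralD//; last 2 first. exact: integrable_Im. exact: integrable_Im.
  by apply/eqP/eq_Rintegral => x _; rewrite cImD.
Qed.

Lemma cintMl (c : Cplane R) h a b : continuous h ->
  cint a b (fun x => c * h x) = c * cint a b h.
Proof.
move=> ch; have iR := integrable_Re a b ch; have iI := integrable_Im a b ch.
have scale (r : R) (f : R -> R) : continuous f ->
    mu.-integrable `[a, b] (EFin \o (fun x => r * f x)).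
  move=> cf; apply: continuous_integrable => x.
  by apply: cvgM; [exact: cvg_cst|exact: cf].
have sR r := scale r _ (continuous_Re ch).
have sI r := scale r _ (continuous_Im ch).
apply/eqP; rewrite eq_complex cReM cImM /=; apply/andP; split; apply/eqP.
- rewrite -!RintegralZl// -RintegralB//.
  by apply: eq_Rintegral => x _; rewrite cReM.
- rewrite -!RintegralZl// -RintegralD//.
  by apply: eq_Rintegral => x _; rewrite cImM.
Qed.

Lemma cintN h a b : continuous h -> cint a b (fun x => - h x) = - cint a b h.
Proof.
move=> ch; rewrite -mulN1r -cintMl//.
by apply: eq_cint => x _; rewrite mulN1r.
Qed.

Lemma cintB h k a b : continuous h -> continuous k ->
  cint a b (fun x => h x - k x) = cint a b h - cint a b k.
Proof.
move=> ch ck; have cNk : continuous (fun x => - k x).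
  by move=> x; exact: (copp_continuous (ck x)).
by rewrite (cintD a b ch cNk) (cintN a b ck).
Qed.

Lemma cint_conj h a b : continuous h ->
  cint a b (fun x => (h x)^*) = (cint a b h)^*.
Proof.
move=> ch; congr (_ +i* _).
  by apply: eq_Rintegral => x _; case: (h x).
rewrite -mulN1r -RintegralZl//; last exact: integrable_Im.
by apply: eq_Rintegral => x _; case: (h x) => u v /=; rewrite mulN1r.
Qed.

(** The factor 2 comes from bounding the two coordinates separately. *)
Lemma cint_le h a b (M : R) : a <= b -> continuous h ->
  (forall x, a <= x <= b -> normc (h x) <= M) ->
  normc (cint a b h) <= 2 * M * (b - a).
Proof.
move=> ab ch hM.
have bnd (f : R -> R) : continuous f -> (forall x, `|f x| <= normc (h x)) ->
    `|\int[mu]_(x in `[a, b]) f x| <= M * (b - a).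
  move=> cf fh; rewrite -Rintegral_const// (le_trans (le_normr_Rintegral _ _))//.
    exact: continuous_integrable.
  apply: Rintegral_le; last by move=> x /hM; exact: le_trans.
  - by move=> x; apply: continuous_comp; [exact: cf|exact: norm_continuous].
  - exact: cst_continuous.
rewrite (le_trans (normc_le_ReIm _))//= -mulrA mulr_natl mulr2n lerD//.
- by apply: bnd => [|x]; [exact: continuous_Re|exact: normc_Re].
- by apply: bnd => [|x]; [exact: continuous_Im|exact: normc_Im].
Qed.

Lemma cint_FTC2 h H a b : a < b -> continuous h ->
  (forall x, a <= x <= b -> rderiv R H x (h x)) -> cint a b h = H b - H a.
Proof.
move=> ab ch dH; apply/eqP; rewrite eq_complex cReD cImD cReN cImN /=.
apply/andP; split; apply/eqP.
- apply: (Rintegral_FTC2 (F := fun x => complex.Re (H x))) => //.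
    exact: continuous_Re.
  by move=> x /dH/rderiv_ReIm[].
- apply: (Rintegral_FTC2 (F := fun x => complex.Im (H x))) => //.
    exact: continuous_Im.
  by move=> x /dH/rderiv_ReIm[].
Qed.

Lemma cint_FTC1 h a x : continuous h -> a < x ->
  rderiv R (fun y => cint a y h) x (h x).
Proof.
move=> ch ax.
have dR := rderiv_real (Rintegral_FTC1 (continuous_Re ch) ax).
have dI := rderiv_real (Rintegral_FTC1 (continuous_Im ch) ax).
rewrite (complexE (h x)).
apply: has_deriv_ext (has_derivD dR (has_derivMl (@creal_continuous R) 'i dI)) => y.
by rewrite [RHS]complexE.
Qed.

Lemma continuous_bounded h a b : continuous h ->
  exists2 M : R, 0 <= M & forall x, a <= x <= b -> normc (h x) <= M.
Proof.
move=> ch; have [ab|ba] := leP a b; last first.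
  by exists 0 => // x /andP[ax xb]; move: (le_lt_trans (le_trans ax xb) ba); rewrite ltxx.
have cn : {within `[a, b], continuous (fun x => normc (h x))}.
  by apply: continuous_subspaceT => x; apply: continuous_normc; exact: ch.
have [c _ H] := EVT_max ab cn.
by exists (normc (h c)); [exact: normc_ge0|move=> x xab; apply: H; rewrite in_itv].
Qed.
End ComplexIntegral.

(** * Integrals along segments and triangles *)

Definition seg (R : realType) (a b : Cplane R) (t : R) : Cplane R :=
  a + t%:C * (b - a).

Definition seg_int (R : realType) (f : Cplane R -> Cplane R) (a b : Cplane R) :=
  (b - a) * cint 0 1 (fun t => f (seg a b t)).

(** The triangle is given by a vertex and two edge vectors: its four quarters
    have edge vectors [u / 2] and [v / 2] or their opposites, so that bisecting
    it repeatedly only changes a vertex and a real scale. *)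
Definition tri_int (R : realType) (f : Cplane R -> Cplane R) (a u v : Cplane R) :=
  seg_int f a (a + u) + seg_int f (a + u) (a + v) + seg_int f (a + v) a.

Section SegmentIntegral.
Variables (R : realType).
Implicit Types (f g : Cplane R -> Cplane R) (a b c u v z w : Cplane R) (t : R).
Local Notation normc := (@Normc.normc R).

Lemma seg0 a b : seg a b 0 = a. Proof. by rewrite /seg mul0r addr0. Qed.
Lemma seg1 a b : seg a b 1 = b. Proof. by rewrite /seg mul1r addrC subrK. Qed.

Lemma rderiv_seg a b t : rderiv R (seg a b) t (b - a).
Proof.
have := has_derivD (has_deriv_cst (@real_complex_def R (Phant R)) a t)
  (has_derivM (@creal_continuous R) (has_deriv_iota (@real_complex_def R (Phant R)) t)
    (has_deriv_cst (@real_complex_def R (Phant R)) (b - a) t)).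
by rewrite mulr0 addr0 add0r mul1r.
Qed.

Lemma seg_continuous a b : continuous (seg a b : R -> Cplane R).
Proof. by move=> t; exact (has_deriv_continuous (@creal_continuous R) (rderiv_seg a b t)). Qed.

Lemma comp_seg_continuous f a b : continuous f ->
  continuous (fun t => f (seg a b t)).
Proof. by move=> cf t; exact (cvg_comp _ _ (@seg_continuous a b t) (cf _)). Qed.

Arguments comp_seg_continuous {f} a b _.

Lemma normc_seg_le a b c t (r : R) : 0 <= t <= 1 ->
  normc (a - c) <= r -> normc (b - c) <= r -> normc (seg a b t - c) <= r.
Proof.
move=> /andP[t0 t1] ar br.
rewrite (_ : seg a b t - c = (1 - t)%:C * (a - c) + t%:C * (b - c)); last first.
  by rewrite rmorphB /seg /=; ring.
rewrite (le_trans (ler_normcD _ _))// !Normc.normcM !normc_real !ger0_norm ?subr_ge0//.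
rewrite (@le_trans _ _ ((1 - t) * r + t * r))//; last by rewrite -mulrDl subrK mul1r.
by rewrite lerD// ler_wpM2l ?subr_ge0.
Qed.

Lemma seg_int_le g a b (M : R) : continuous g ->
  (forall t, 0 <= t <= 1 -> normc (g (seg a b t)) <= M) ->
  normc (seg_int g a b) <= normc (b - a) * (2 * M).
Proof.
move=> cg gM; rewrite /seg_int Normc.normcM ler_wpM2l ?normc_ge0//.
have := @cint_le _ _ 0 1 M ler01 (comp_seg_continuous a b cg) gM.
by rewrite subr0 mulr1.
Qed.

Lemma seg_int_primitive f F a b : continuous f ->
  (forall w, cderiv F w (f w)) -> seg_int f a b = F b - F a.
Proof.
move=> cf dF; have cfs := comp_seg_continuous a b cf.
rewrite /seg_int -cintMl// -[b in F b](seg1 a b) -[a in X in _ - F X](seg0 a b).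
apply: (cint_FTC2 (H := fun t => F (seg a b t)) ltr01).
  by move=> t; exact (cmul_continuous (ccst_continuous (b - a) t) (cfs t)).
move=> t _; rewrite mulrC.
exact (has_deriv_comp (@creal_continuous R) (dF _) (rderiv_seg a b t)).
Qed.

Lemma seg_intB f g a b : continuous f -> continuous g ->
  seg_int (fun w => f w - g w) a b = seg_int f a b - seg_int g a b.
Proof.
move=> cf cg; rewrite /seg_int -mulrBr; congr (_ * _).
exact: (cintB 0 1 (comp_seg_continuous a b cf) (comp_seg_continuous a b cg)).
Qed.

(** Integrals over all subsegments of one segment come from a single primitive
    along it; additivity and orientation follow. *)
Lemma seg_int_sub f a b : continuous f -> exists H : R -> Cplane R,
  forall p q, 0 <= p <= 1 -> 0 <= q <= 1 ->
    seg_int f (seg a b p) (seg a b q) = (b - a) * (H q - H p).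
Proof.
move=> cf; pose h t := f (seg a b t).
have ch : continuous h := comp_seg_continuous a b cf.
exists (fun y => cint (-1) y h) => p q /andP[p0 p1] /andP[q0 q1].
pose k (t : R) := p + t * (q - p).
have kE t : seg (seg a b p) (seg a b q) t = seg a b (k t).
  by rewrite /seg /k rmorphD rmorphM rmorphB /=; ring.
rewrite /seg_int.
have -> : seg a b q - seg a b p = (b - a) * (q - p)%:C.
  by rewrite /seg rmorphB /=; ring.
rewrite -mulrA; congr (_ * _).
have dk t : is_derive t (1 : R) k (q - p).
  by rewrite /k; apply: is_derive_eq; rewrite /GRing.scale/=; ring.
have ck : continuous k.
  by move=> t; have [dkt _] := dk t; apply/differentiable_continuous/derivable1_diffP.
have chk : continuous (fun t => h (k t)).
  by move=> t; exact (cvg_comp _ _ (ck t) (ch _)).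
rewrite -cintMl; last by under eq_fun do rewrite kE.
under [X in cint _ _ X]eq_fun do rewrite kE.
have -> : q = k 1 by rewrite /k; ring.
have -> : p = k 0 by rewrite /k; ring.
rewrite (_ : k 1 - k 0 = q - p); last by rewrite /k; ring.
apply: (cint_FTC2 (H := fun t => cint (-1) (k t) h) ltr01).
  by move=> t; exact (cmul_continuous (ccst_continuous (q - p)%:C t) (chk t)).
move=> t /andP[t0 t1]; rewrite mulrC.
have dH : rderiv R (fun y => cint (-1) y h) (k t) (h (k t)).
  by apply: (cint_FTC1 ch); rewrite /k; nra.
exact (has_deriv_chain (ck t) dH (rderiv_real (dk t))).
Qed.

Lemma seg_int_rev f a b : continuous f -> seg_int f b a = - seg_int f a b.
Proof.
move=> /(seg_int_sub a b)[H HE].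
have := HE 1 0; have := HE 0 1; rewrite !seg0 !seg1 !lexx !ler01.
by move=> -> // ->//; ring.
Qed.

Lemma seg_int_mid f a b : continuous f ->
  seg_int f a ((a + b) / 2) + seg_int f ((a + b) / 2) b = seg_int f a b.
Proof.
move=> /(seg_int_sub a b)[H HE].
have mid : (a + b) / 2 = seg a b 2^-1.
  by rewrite /seg fmorphV rmorph_nat /=; field.
have h01 : 0 <= (2^-1 : R) <= 1 by rewrite invr_ge0 ler0n invf_le1 ?ler1n ?ltr0n.
have := HE 0 2^-1; have := HE 2^-1 1; have := HE 0 1.
rewrite -mid !seg0 !seg1 !lexx !ler01 h01.
by move=> -> // -> // -> //; ring.
Qed.

Lemma tri_int_split f a u v : continuous f ->
  tri_int f a u v = tri_int f a (u / 2) (v / 2) +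
    tri_int f (a + u / 2) (u / 2) (v / 2) +
    tri_int f (a + v / 2) (u / 2) (v / 2) +
    tri_int f (a + (u + v) / 2) (- (u / 2)) (- (v / 2)).
Proof.
move=> cf; rewrite /tri_int.
rewrite -(seg_int_mid a (a + u) cf) -(seg_int_mid (a + u) (a + v) cf).
rewrite -(seg_int_mid (a + v) a cf).
have -> : (a + (a + u)) / 2 = a + u / 2 by field.
have -> : (a + u + (a + v)) / 2 = a + (u + v) / 2 by field.
have -> : (a + v + a) / 2 = a + v / 2 by field.
have -> : a + u / 2 + u / 2 = a + u by field.
have -> : a + u / 2 + v / 2 = a + (u + v) / 2 by field.
have -> : a + v / 2 + u / 2 = a + (u + v) / 2 by field.
have -> : a + v / 2 + v / 2 = a + v by field.
have -> : a + (u + v) / 2 - u / 2 = a + v / 2 by field.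
have -> : a + (u + v) / 2 - v / 2 = a + u / 2 by field.
rewrite (seg_int_rev (a + u / 2) (a + v / 2) cf).
rewrite (seg_int_rev (a + u / 2) (a + (u + v) / 2) cf).
rewrite (seg_int_rev (a + v / 2) (a + (u + v) / 2) cf).
ring.
Qed.

Lemma tri_int_primitive f F a u v : continuous f ->
  (forall w, cderiv F w (f w)) -> tri_int f a u v = 0.
Proof.
by move=> cf dF; rewrite /tri_int !(seg_int_primitive _ _ cf dF); ring.
Qed.

Lemma tri_intB f g a u v : continuous f -> continuous g ->
  tri_int (fun w => f w - g w) a u v = tri_int f a u v - tri_int g a u v.
Proof. by move=> cf cg; rewrite /tri_int !(seg_intB _ _ cf cg); ring. Qed.

(** 6 is three edges times the factor 2 of [cint_le]. *)
Lemma tri_int_le g a u v (L M : R) : continuous g ->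
  normc u + normc v <= L ->
  (forall w, normc (w - a) <= L -> normc (g w) <= M) ->
  normc (tri_int g a u v) <= 6 * L * M.
Proof.
move=> cg uvL gM.
have u0 := normc_ge0 u; have v0 := normc_ge0 v.
have [uL vL] : normc u <= L /\ normc v <= L by split; lra.
have a0 : normc (a - a) <= L by rewrite subrr Normc.normc0; lra.
have auL : normc (a + u - a) <= L by rewrite addrC addKr.
have avL : normc (a + v - a) <= L by rewrite addrC addKr.
have M0 : 0 <= M by apply: le_trans (gM a a0); exact: normc_ge0.
have edge b c : normc (b - a) <= L -> normc (c - a) <= L -> normc (c - b) <= L ->
    normc (seg_int g b c) <= 2 * L * M.
  move=> bL cL bcL; have := @seg_int_le g b c M cg.
  have H t : 0 <= t <= 1 -> normc (g (seg b c t)) <= M.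
    by move=> t01; apply: gM; exact: normc_seg_le.
  move=> /(_ H) /le_trans; apply.
  by rewrite mulrCA mulrA ler_wpM2r// ler_wpM2l.
have e1 := edge _ _ a0 auL auL.
have e2 : normc (seg_int g (a + u) (a + v)) <= 2 * L * M.
  apply: edge => //; rewrite (_ : _ - _ = v - u); last by ring.
  by rewrite (le_trans (ler_normcB _ _))// addrC.
have e3 : normc (seg_int g (a + v) a) <= 2 * L * M.
  by apply: edge => //; rewrite normcB.
have h1 := ler_normcD (seg_int g a (a + u) + seg_int g (a + u) (a + v)) (seg_int g (a + v) a).
have h2 := ler_normcD (seg_int g a (a + u)) (seg_int g (a + u) (a + v)).
by rewrite /tri_int; lra.
Qed.
End SegmentIntegral.
Arguments comp_seg_continuous {R f} a b _.

(** * Goursat's lemma *)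

Section Nested.
Variable R : realType.

(** Nested intervals: x n - 2L/2^n increases and x n + 2L/2^n decreases. *)
Lemma geometric_limit (x : nat -> R) (L : R) : 0 <= L ->
  (forall n, `|x n.+1 - x n| <= L / 2 ^+ n) ->
  exists p, forall n, `|x n - p| <= 2 * L / 2 ^+ n.
Proof.
move=> L0 H.
have half n : (2 ^+ n.+1)^-1 = (2 ^+ n)^-1 / 2 :> R by rewrite exprS invfM mulrC.
have pos n : 0 < (2 ^+ n)^-1 :> R by rewrite invr_gt0 exprn_gt0.
pose b n := x n - 2 * L / 2 ^+ n; pose c n := x n + 2 * L / 2 ^+ n.
have bS n : b n <= b n.+1.
  rewrite /b half; have := H n; rewrite ler_norml => /andP[+ _].
  by move: (2 ^+ n)^-1 (pos n) => e e0; lra.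
have cS n : c n.+1 <= c n.
  rewrite /c half; have := H n; rewrite ler_norml => /andP[_].
  by move: (2 ^+ n)^-1 (pos n) => e e0; lra.
have bm n m : (n <= m)%N -> b n <= b m.
  by move=> /subnK <-; elim: (m - n)%N => // k /le_trans; apply; rewrite addSn.
have cm n m : (n <= m)%N -> c m <= c n.
  by move=> /subnK <-; elim: (m - n)%N => // k; apply: le_trans; rewrite addSn.
have bc n : b n <= c n.
  by rewrite /b /c; move: (2 ^+ n)^-1 (pos n) => e e0; nra.
have bcm n m : b n <= c m.
  apply: le_trans (bm _ (maxn n m) (leq_maxl _ _)) _.
  by apply: le_trans (bc _) (cm _ _ (leq_maxr _ _)).
exists (sup (range b)) => n.
have ub : ubound (range b) (c n) by move=> _ [m _ <-].
have hb : has_sup (range b) by split; [exists (b 0%N), 0%N|exists (c n)].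
have h1 : sup (range b) <= c n by apply: ge_sup => //; exists (b 0%N), 0%N.
have h2 : b n <= sup (range b) by apply: ub_le_sup; [exists (c n)|exists n].
by rewrite ler_norml; move: h1 h2; rewrite /b /c => h1 h2; lra.
Qed.

Lemma geometric_climit (z : nat -> Cplane R) (L : R) : 0 <= L ->
  (forall n, Normc.normc (z n.+1 - z n) <= L / 2 ^+ n) ->
  exists p, forall n, Normc.normc (z n - p) <= 4 * L / 2 ^+ n.
Proof.
move=> L0 H.
have [n|p pP] := @geometric_limit (fun n => complex.Re (z n)) L L0.
  by rewrite -cReN -cReD; apply: le_trans (H n); exact: normc_Re.
have [n|q qP] := @geometric_limit (fun n => complex.Im (z n)) L L0.
  by rewrite -cImN -cImD; apply: le_trans (H n); exact: normc_Im.
exists (p +i* q) => n; apply: le_trans (normc_le_ReIm _) _.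
rewrite cReD cImD cReN cImN /=.
by have := pP n; have := qP n; lra.
Qed.

Lemma geometric_small (M e : R) : 0 < e -> exists n : nat, M / 2 ^+ n < e.
Proof.
move=> e0; have [n nM] : exists n : nat, M / e < n%:R.
  exists (Num.truncn (M / e)).+1; exact: Num.Theory.truncnS_gt.
exists n; rewrite ltr_pdivrMr ?exprn_gt0// mulrC -ltr_pdivrMr//.
rewrite (lt_trans nM)// -natrX ltr_nat.
exact: ltn_expl.
Qed.
End Nested.

Section Goursat.
Variable R : realType.
Implicit Types (f : Cplane R -> Cplane R) (a u v w z : Cplane R) (l r : R).
Local Notation normc := (@Normc.normc R).

Let inside r u v (s : Cplane R * R) :=
  [/\ normc s.1 <= r, normc (s.1 + s.2%:C * u) <= r & normc (s.1 + s.2%:C * v) <= r].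

(** A state [s] stands for the triangle at [s.1] with edge vectors [s.2 * u] and
    [s.2 * v]; [t] is a quarter of it that carries at least a quarter of the
    integral. *)
Let halving f r u v (s t : Cplane R * R) :=
  inside r u v s ->
  [/\ inside r u v t, `|t.2| = `|s.2| / 2,
      normc (t.1 - s.1) <= (normc u + normc v) * `|s.2| &
      normc (tri_int f s.1 (s.2%:C * u) (s.2%:C * v)) <=
      4 * normc (tri_int f t.1 (t.2%:C * u) (t.2%:C * v))].

Let mid_inside r z w : normc z <= r -> normc w <= r -> normc ((z + w) / 2) <= r.
Proof.
move=> zr wr; rewrite Normc.normcM Normc.normcV.
have -> : normc 2 = 2 by rewrite -(rmorph_nat (real_complex R) 2) normc_real ger0_norm.
by rewrite ler_pdivrMr// (le_trans (ler_normcD _ _))//; lra.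
Qed.

Let ex_halving f r u v s : continuous f -> exists t, halving f r u v s t.
Proof.
move=> cf; case: s => a l.
have half (x : Cplane R) : l%:C * x / 2 = (l / 2)%:C * x.
  by rewrite rmorphM fmorphV rmorph_nat /=; field.
have halfN (x : Cplane R) : - (l%:C * x / 2) = (- (l / 2))%:C * x.
  by rewrite half rmorphN mulNr.
have nhalf (x : Cplane R) : normc (l%:C * x / 2) = normc x * `|l| / 2.
  by rewrite half Normc.normcM normc_real normrM (@ger0_norm _ 2^-1)//; ring.
have split4 := tri_int_split a (l%:C * u) (l%:C * v) cf.
have u0 := normc_ge0 u; have v0 := normc_ge0 v.
have lu0 : 0 <= normc u * `|l| by rewrite mulr_ge0.
have lv0 : 0 <= normc v * `|l| by rewrite mulr_ge0.
have l2 : `|l / 2| = `|l| / 2 by rewrite normrM (@ger0_norm _ 2^-1).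
set T := tri_int f a _ _ in split4.
set T1 := tri_int f a _ _ in split4.
set T2 := tri_int f (a + l%:C * u / 2) _ _ in split4.
set T3 := tri_int f (a + l%:C * v / 2) _ _ in split4.
set T4 := tri_int f (a + (_ + _) / 2) _ _ in split4.
have : normc T <= normc T1 + normc T2 + normc T3 + normc T4.
  rewrite split4 (le_trans (ler_normcD _ _))// lerD2r.
  by rewrite (le_trans (ler_normcD _ _))// lerD2r ler_normcD.
have mid1 : (a + (a + l%:C * u)) / 2 = a + l%:C * u / 2 by field.
have mid2 : (a + (a + l%:C * v)) / 2 = a + l%:C * v / 2 by field.
have mid3 : (a + l%:C * u + (a + l%:C * v)) / 2 = a + (l%:C * u + l%:C * v) / 2 by field.
move=> Tle.
have [h1|h1] := leP (normc T) (4 * normc T1).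
  exists (a, l / 2) => -[/= ar ur vr]; split => //=; last by rewrite -!half.
    by split => //=; rewrite -half -?mid1 -?mid2; exact: mid_inside.
  by rewrite subrr Normc.normc0 mulr_ge0 ?addr_ge0.
have [h2|h2] := leP (normc T) (4 * normc T2).
  exists (a + l%:C * u / 2, l / 2) => -[/= ar ur vr]; split => //=; last by rewrite -!half.
    split => /=; rewrite -?half.
    - by rewrite -mid1; exact: mid_inside.
    - by rewrite -addrA -mulrDl -mulr2n -[_ *+ 2]mulr_natr mulfK.
    - by rewrite -addrA -mulrDl -mid3; exact: mid_inside.
  by rewrite addrC addKr nhalf; lra.
have [h3|h3] := leP (normc T) (4 * normc T3).
  exists (a + l%:C * v / 2, l / 2) => -[/= ar ur vr]; split => //=; last by rewrite -!half.
    split => /=; rewrite -?half.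
    - by rewrite -mid2; exact: mid_inside.
    - by rewrite -addrA -mulrDl addrC [_ * v + _]addrC addrC -mid3; exact: mid_inside.
    - by rewrite -addrA -mulrDl -mulr2n -[_ *+ 2]mulr_natr mulfK.
  by rewrite addrC addKr nhalf; lra.
have [h4|h4] := leP (normc T) (4 * normc T4); last by lra.
exists (a + (l%:C * u + l%:C * v) / 2, - (l / 2)) => -[/= ar ur vr].
split => //=; last by rewrite -!halfN.
- split => /=; rewrite -?halfN.
  + by rewrite -mid3; exact: mid_inside.
  + rewrite (_ : _ - _ = a + l%:C * v / 2); last by field.
    by rewrite -mid2; exact: mid_inside.
  + rewrite (_ : _ - _ = a + l%:C * u / 2); last by field.
    by rewrite -mid1; exact: mid_inside.
- by rewrite normrN.
- rewrite addrC addKr mulrDl (le_trans (ler_normcD _ _))// !nhalf.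
  by lra.
Qed.

(** Repeated halving shrinks the triangle to a point [p] of the disc. There [f]
    is affine up to [o(|w - p|)] and affine functions have primitives, so the
    n-th triangle carries only [o(4^-n)], although it was chosen to carry at
    least [4^-n] times the initial integral. *)
Theorem tri_int_eq0 f r (rho : R) a u v : continuous f -> r < rho ->
  (forall z, normc z < rho -> exists d, cderiv f z d) ->
  normc a <= r -> normc (a + u) <= r -> normc (a + v) <= r ->
  tri_int f a u v = 0.
Proof.
move=> cf rrho df ar ur vr.
have /choice[next nextP] : forall s, exists t, halving f r u v s t.
  by move=> s; exact: ex_halving.
pose s n := iter n next (a, 1); pose L := normc u + normc v.
have L0 : 0 <= L by rewrite addr_ge0 ?normc_ge0.
have s0 : inside r u v (s 0%N) by split; rewrite /= ?mul1r.
have sin n : inside r u v (s n).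
  by elim: n => // n IH; have [] := nextP (s n) IH.
have sl n : `|(s n).2| = (2 ^+ n)^-1.
  elim: n => [|n IH]; first by rewrite /= normr1 expr0 invr1.
  by have [_ -> _ _] := nextP (s n) (sin n); rewrite IH exprS invfM mulrC.
have sa n : normc ((s n.+1).1 - (s n).1) <= L / 2 ^+ n.
  by have [_ _ + _] := nextP (s n) (sin n); rewrite sl.
pose T n := tri_int f (s n).1 ((s n).2%:C * u) ((s n).2%:C * v).
have sT n : normc (T 0%N) <= 4 ^+ n * normc (T n).
  elim: n => [|n IH]; first by rewrite expr0 mul1r.
  have [_ _ _ h] := nextP (s n) (sin n).
  by rewrite (le_trans IH)// exprSr -mulrA ler_wpM2l// exprn_ge0.
have [p pP] := geometric_climit L0 sa.
have prho : normc p < rho.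
  apply: le_lt_trans rrho; rewrite leNgt; apply/negP => rp.
  have [|n nP] := @geometric_small R (4 * L) (normc p - r); first by rewrite subr_gt0.
  have [h _ _] := sin n.
  have := ler_normcD (p - (s n).1) (s n).1; rewrite subrK normcB.
  by have := pP n; lra.
have [d dp] := df p prho.
have T0 : T 0%N = tri_int f a u v by rewrite /T /s /= !mul1r.
rewrite -T0; apply: Normc.eq0_normc; apply/eqP.
rewrite eq_le normc_ge0 andbT; apply/ler_addgt0Pr => e e0; rewrite add0r.
(* 30 = 6 * 5: [tri_int_le] is applied to a triangle of size [L / 2 ^+ n] whose
   points lie within [5 * L / 2 ^+ n] of [p]. *)
have e'0 : 0 < e / (30 * L ^+ 2 + 1).
  by rewrite divr_gt0// ltr_pwDr// mulr_ge0// exprn_ge0.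
move: (dp) => /cderivP/(_ _ e'0)[del del0 hdel].
have [n nP] := @geometric_small R (5 * L) _ del0.
(* The affine part of [f] at [p] and a primitive of it. *)
pose A w := f p + d * (w - p).
pose B w := f p * w + d / 2 * (w - p) ^+ 2.
have dB w : cderiv B w (A w).
  have cid := @cid_continuous R.
  have d1 := has_derivMl cid (f p) (has_deriv_iota (id : Cplane R -> _) w).
  have d2 := has_derivB (has_deriv_iota (id : Cplane R -> _) w) (has_deriv_cst id p w).
  have d3 := has_derivMl cid (d / 2) (has_derivX cid 2 d2).
  have := has_derivD d1 d3; rewrite (_ : _ + _ = A w)//.
  by rewrite /A /= expr1; field.
have cA : continuous A.
  move=> w; rewrite /A.
  exact (cadd_continuous (ccst_continuous (f p) w)
    (cmul_continuous (ccst_continuous d w)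
      (csub_continuous (@cid_continuous R w) (ccst_continuous p w)))).
have TE : T n = tri_int (fun w => f w - A w) (s n).1 ((s n).2%:C * u) ((s n).2%:C * v).
  by rewrite (tri_intB _ _ _ cf cA) (tri_int_primitive _ _ _ cA dB) subr0.
have cE : continuous (fun w => f w - A w).
  by move=> w; exact (csub_continuous (cf w) (cA w)).
pose q : R := (2 ^+ n)^-1.
have q0 : 0 < q by rewrite invr_gt0 exprn_gt0.
have Tn : normc (T n) <= 6 * (L * q) * (e / (30 * L ^+ 2 + 1) * (5 * L * q)).
  rewrite TE; apply: tri_int_le => //.
    by rewrite !Normc.normcM !normc_real sl -mulrDr mulrC.
  move=> w wL.
  have wp : normc (w - p) <= 5 * L * q.
    have := ler_normcD (w - (s n).1) ((s n).1 - p); rewrite addrA subrK.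
    by have := pP n; rewrite -/q; lra.
  rewrite (_ : _ - _ = f w - f p - d * (w - p)); last by rewrite /A; ring.
  rewrite (le_trans (hdel w _))//; first exact: le_lt_trans wp nP.
  by rewrite ler_wpM2l// ltW.
apply: le_trans (sT n) _.
have q4 : 4 ^+ n * (q * q) = 1.
  by rewrite /q -invfM -exprMn -natrM divff// expf_neq0.
apply: (@le_trans _ _ (4 ^+ n * (6 * (L * q) * (e / (30 * L ^+ 2 + 1) * (5 * L * q))))).
  by rewrite ler_wpM2l// exprn_ge0.
rewrite (_ : _ * _ = (4 ^+ n * (q * q)) * (30 * L ^+ 2 * (e / (30 * L ^+ 2 + 1)))); last by ring.
rewrite q4 mul1r mulrA ler_pdivrMr ?ltr_pwDr// ?mulr_ge0 ?exprn_ge0//.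
by have := e0; nra.
Qed.
End Goursat.

(** * Primitives in a disc *)

Definition holo_disc (R : realType) (rho : R) (f : Cplane R -> Cplane R) :=
  forall z, Normc.normc z < rho -> exists d, cderiv f z d.

Section Primitive.
Variable R : realType.
Implicit Types (f F : Cplane R -> Cplane R) (z w : Cplane R) (r rho : R).
Local Notation normc := (@Normc.normc R).

Lemma cderiv_continuous f z d : cderiv f z d -> {for z, continuous f}.
Proof. by move=> fd; exact (has_deriv_continuous (@cid_continuous R) fd). Qed.

(** By Goursat's lemma on the triangle [0, z, w], the increment of [seg_int f 0]
    from [z] to [w] is the integral over the segment between them. *)
Lemma seg_int_derive f rho z : continuous f -> holo_disc rho f ->
  normc z < rho -> cderiv (seg_int f 0) z (f z).
Proof.
move=> cf hf zrho; apply/cderivP => e e0.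
have e20 : 0 < e / 2 by rewrite divr_gt0.
have /continuous_normcP/(_ _ e20) := cf z.
move=> /(nbhs_normcP z)[d d0 hd].
exists (Num.min d (rho - normc z)); first by rewrite lt_min d0 subr_gt0.
move=> w; rewrite lt_min => /andP[wd wr].
have wrho : normc w < rho.
  by have := ler_normcD (w - z) z; rewrite subrK; lra.
pose r := Num.max (normc z) (normc w).
have rrho : r < rho by rewrite gt_max zrho.
have r0 : normc 0 <= r by rewrite Normc.normc0 le_max normc_ge0.
have := @tri_int_eq0 _ f r rho 0 z w cf rrho hf r0.
rewrite /tri_int !add0r !le_max !lexx orbT => /(_ isT isT).
rewrite (seg_int_rev 0 w cf) => /eqP; rewrite subr_eq0 addrC => /eqP E.
rewrite -E addrK /seg_int.
have cfs := comp_seg_continuous z w cf.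
have -> : f z = cint 0 1 (fun=> f z).
  rewrite (@cint_FTC2 R _ (fun t : R => f z * t%:C) _ _ ltr01).
  - by rewrite mulr0 subr0 mulr1.
  - by move=> t; exact (ccst_continuous (f z) t).
  - move=> t _.
    have := has_derivMl (@creal_continuous R) (f z)
      (has_deriv_iota (@real_complex_def R (Phant R)) t).
    by rewrite mulr1.
rewrite mulrC -mulrBl -cintB; [|exact cfs|by move=> t; exact (ccst_continuous (f z) t)].
rewrite Normc.normcM ler_wpM2r ?normc_ge0//.
have -> : e = 2 * (e / 2) * (1 - 0) by rewrite subr0; field.
apply: (cint_le ler01).
  by move=> t; exact (csub_continuous (cfs t) (ccst_continuous (f z) t)).
move=> t t01; apply/ltW/hd; apply: le_lt_trans wd; apply: normc_seg_le => //.
by rewrite subrr Normc.normc0 normc_ge0.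
Qed.

(** The radial retraction onto a smaller closed disc makes [f] continuous on the
    whole plane without changing it on that disc. *)
Lemma holo_primitive f r rho : 0 < r -> r < rho -> holo_disc rho f ->
  exists F, forall z, normc z < r -> cderiv F z (f z).
Proof.
move=> r0 rrho hf.
pose m z := Num.max r (normc z).
have m0 z : 0 < m z by rewrite lt_max r0.
pose p z : Cplane R := (r / m z)%:C * z.
have pE z : normc z <= r -> p z = z.
  by move=> zr; rewrite /p /m max_l// divff ?mul1r// gt_eqF.
have pr z : normc (p z) <= r.
  rewrite /p Normc.normcM normc_real ger0_norm; last by rewrite divr_ge0 ?ltW.
  have -> : r / m z * normc z = r * normc z / m z by rewrite mulrAC.
  rewrite ler_pdivrMr ?m0// ler_wpM2l ?(ltW r0)//.
  by rewrite le_max lexx orbT.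
have cp : continuous p.
  move=> z; apply: (cmul_continuous _ (@cid_continuous R z)).
  apply: continuous_real.
  have cm : {for z, continuous m}.
    apply: continuous_max; first exact: cst_continuous.
    exact (continuous_normc (@cid_continuous R z)).
  have mz : m z != 0 by rewrite gt_eqF.
  have cr : {for z, continuous (fun=> r : R)} by exact: cst_continuous.
  exact (cvgM cr (cvgV mz cm)).
have cfp : continuous (fun z => f (p z)).
  move=> z; have [d fd] := hf (p z) (le_lt_trans (pr z) rrho).
  exact (cvg_comp _ _ (cp z) (cderiv_continuous fd)).
have nearp z : normc z < r -> \forall w \near z, f w = f (p w).
  move=> zr; apply/(nbhs_normcP z); exists (r - normc z); first by rewrite subr_gt0.
  move=> w wz; rewrite pE//.
  by have := ler_normcD (w - z) z; rewrite subrK; lra.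
have hfp : holo_disc r (fun z => f (p z)).
  move=> z zr; have [d fd] := hf z (lt_trans zr rrho).
  by exists d; exact: has_deriv_near (nearp z zr) fd.
exists (seg_int (fun z => f (p z)) 0) => z zr.
rewrite -{2}(pE z (ltW zr)).
exact: (seg_int_derive cfp hfp zr).
Qed.

(** The real mean value theorem for each coordinate along the segment. *)
Lemma cderiv_mean_value (F f : Cplane R -> Cplane R) a b (M : R) :
  (forall t : R, 0 <= t <= 1 -> cderiv F (seg a b t) (f (seg a b t))) ->
  (forall t : R, 0 <= t <= 1 -> normc (f (seg a b t)) <= M) ->
  normc (F b - F a) <= 2 * M * normc (b - a).
Proof.
move=> dF fM.
have key (G dG : R -> R) : (forall t : R, 0 <= t <= 1 -> is_derive t (1 : R) G (dG t)) ->
    (forall t : R, 0 <= t <= 1 -> `|dG t| <= M * normc (b - a)) ->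
    `|G 1 - G 0| <= M * normc (b - a).
  move=> GdG dGM.
  have [||c c01 ->] := @MVT_segment R G dG 0 1 ler01.
  - by move=> t; rewrite in_itv/= => /andP[t0 t1]; apply: GdG; rewrite !ltW.
  - apply: derivable_within_continuous => t; rewrite in_itv/= => t01.
    by have [] := GdG t t01.
  - by rewrite subr0 mulr1; apply: dGM; rewrite in_itv/= in c01.
have dFs t : 0 <= t <= 1 ->
    rderiv R (fun u => F (seg a b u)) t (f (seg a b t) * (b - a)).
  by move=> t01; exact (has_deriv_comp (@creal_continuous R) (dF t t01) (rderiv_seg a b t)).
have bnd t : 0 <= t <= 1 -> normc (f (seg a b t) * (b - a)) <= M * normc (b - a).
  by move=> t01; rewrite Normc.normcM ler_wpM2r ?normc_ge0// fM.
have h1 := @key (fun t => complex.Re (F (seg a b t)))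
  (fun t => complex.Re (f (seg a b t) * (b - a))).
have h2 := @key (fun t => complex.Im (F (seg a b t)))
  (fun t => complex.Im (f (seg a b t) * (b - a))).
rewrite !seg0 !seg1 in h1 h2.
rewrite (le_trans (normc_le_ReIm _))// cReD cImD cReN cImN.
rewrite -mulrA mulr_natl mulr2n lerD//.
- apply: h1 => t t01; first by have [] := rderiv_ReIm (dFs t t01).
  exact: le_trans (normc_Re _) (bnd t t01).
- apply: h2 => t t01; first by have [] := rderiv_ReIm (dFs t t01).
  exact: le_trans (normc_Im _) (bnd t t01).
Qed.

Lemma cderiv0_const (F : Cplane R -> Cplane R) rho a b :
  (forall z, normc z < rho -> cderiv F z 0) ->
  normc a < rho -> normc b < rho -> F a = F b.
Proof.
move=> dF ar br; apply/esym/eqP; rewrite -subr_eq0; apply/eqP/Normc.eq0_normc/eqP.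
rewrite eq_le normc_ge0 andbT.
have := @cderiv_mean_value F (fun=> 0) a b 0; rewrite mulr0 mul0r; apply.
- move=> t t01; apply: dF.
  have [r [arr [brr rr]]] : exists r, normc a <= r /\ normc b <= r /\ r < rho.
    by exists (Num.max (normc a) (normc b)); rewrite !le_max !lexx orbT gt_max ar br.
  apply: le_lt_trans rr; rewrite -[seg a b t]subr0; apply: normc_seg_le => //;
  by rewrite subr0.
- by move=> t _; rewrite Normc.normc0.
Qed.

(** At [a] itself the quotient is differentiable because a primitive of a
    holomorphic function has a second-order expansion there. This is what allows
    Cauchy's formula to be read off from Goursat's lemma alone. *)
Lemma quotient_holo (F f : Cplane R -> Cplane R) rho a :
  (forall z, normc z < rho -> cderiv F z (f z)) -> holo_disc rho f ->
  normc a < rho ->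
  holo_disc rho (fun w => if w == a then f a else (F w - F a) / (w - a)).
Proof.
move=> dF hf ar z zr; have cid := @cid_continuous R.
have [->|za] := eqVneq z a; last first.
  have za0 : z - a != 0 by rewrite subr_eq0.
  have d1 := has_derivB (dF z zr) (has_deriv_cst id (F a) z).
  have d2 := has_derivV cid
    (has_derivB (has_deriv_iota (id : Cplane R -> _) z) (has_deriv_cst id a z)) za0.
  eexists; apply: has_deriv_near (has_derivM cid d1 d2).
  apply/(nbhs_normcP z); exists (normc (z - a)); first by rewrite normc_gt0.
  by move=> w wz; case: eqVneq => // wa; move: wz; rewrite wa normcB ltxx.
have [d fd] := hf a ar; exists (d / 2); apply/cderivP => e e0.
have e20 : 0 < e / 2 by rewrite divr_gt0.
move: (fd) => /cderivP/(_ _ e20)[r r0 hr].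
exists (Num.min r (rho - normc a)); first by rewrite lt_min r0 subr_gt0.
move=> w; rewrite lt_min eqxx => /andP[wr wrho].
case: eqVneq => [->|wa]; first by rewrite !subrr mulr0 subrr Normc.normc0 mulr0.
have wa0 : w - a != 0 by rewrite subr_eq0.
pose G w := F w - F a - f a * (w - a) - d / 2 * (w - a) ^+ 2.
have Ga : G a = 0 by rewrite /G !subrr mulr0 expr0n mulr0 !subr0.
have -> : (F w - F a) / (w - a) - f a - d / 2 * (w - a) = (G w - G a) / (w - a).
  by rewrite Ga subr0 /G; field.
rewrite Normc.normcM Normc.normcV ler_pdivrMr ?normc_gt0//.
have -> : e * normc (w - a) = 2 * (e / 2 * normc (w - a)) by field.
apply: (@cderiv_mean_value G (fun w => f w - f a - d * (w - a))).
- move=> t t01; set u := seg a w t.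
  have ua : normc (u - a) <= normc (w - a).
    by apply: normc_seg_le => //; rewrite subrr Normc.normc0 normc_ge0.
  have ur : normc u < rho.
    by have := ler_normcD (u - a) a; rewrite subrK; lra.
  have d0 := has_derivB (has_deriv_iota (id : Cplane R -> _) u) (has_deriv_cst id a u).
  have d1 := has_derivB (dF u ur) (has_deriv_cst id (F a) u).
  have d2 := has_derivMl cid (f a) d0.
  have d3 := has_derivMl cid (d / 2) (has_derivX cid 2 d0).
  have := has_derivB (has_derivB d1 d2) d3.
  rewrite (_ : _ - _ = f u - f a - d * (u - a))//.
  by rewrite /= expr1; field.
- move=> t t01; set u := seg a w t.
  have ua : normc (u - a) <= normc (w - a).
    by apply: normc_seg_le => //; rewrite subrr Normc.normc0 normc_ge0.
  rewrite (le_trans (hr u _))//; first exact: le_lt_trans ua wr.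
  by rewrite ler_wpM2l// ltW.
Qed.
End Primitive.

(** * Cauchy integrals along closed curves in the unit circle *)

Section CauchyTransform.
Variable R : realType.
Local Notation normc := (@Normc.normc R).

(** With [A = 1 / (g - w)], [B = 1 / (g - z)] and [h = w - z] this expands
    [w |-> (g - w) ^- n] at [z], with a remainder uniform in [g]. *)
Lemma inverse_power_taylor (M : R) (n : nat) : 0 <= M -> exists2 K : R, 0 <= K &
  forall A B h : Cplane R, normc A <= M -> normc B <= M -> A - B = A * B * h ->
    normc (A ^+ n - B ^+ n - n%:R * B ^+ n.+1 * h) <= K * normc h ^+ 2.
Proof.
move=> M0; elim: n => [|n [K K0 IH]].
  exists 0 => // A B h _ _ _.
  by rewrite !expr0 subrr !mul0r subrr Normc.normc0.
exists (M * K + n.+1%:R * M ^+ n.+3) => [|A B h AM BM ABh].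
  by rewrite addr_ge0// mulr_ge0// exprn_ge0.
have -> : A ^+ n.+1 - B ^+ n.+1 - n.+1%:R * B ^+ n.+2 * h =
    A * (A ^+ n - B ^+ n - n%:R * B ^+ n.+1 * h) +
    n.+1%:R * (A * B ^+ n.+2) * h ^+ 2.
  have E1 : A ^+ n.+1 = A * A ^+ n by rewrite exprS.
  have E2 : B ^+ n.+1 = B * B ^+ n by rewrite exprS.
  have E3 : B ^+ n.+2 = B * (B * B ^+ n) by rewrite !exprS.
  have AE : A = B + A * B * h by rewrite -ABh addrC subrK.
  rewrite E1 E2 E3 -natr1.
  transitivity (A * (A ^+ n - B ^+ n - n%:R * (B * B ^+ n) * h) +
    B ^+ n * ((A - B) + (n%:R * B * h) * (A - B) - B * (B * h))); first by ring.
  rewrite ABh; congr (_ + _).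
  rewrite [X in _ - X](_ : _ = B * h * (A - A * B * h)); last first.
    by rewrite -ABh; ring.
  by ring.
rewrite (le_trans (ler_normcD _ _))// !(normcX, Normc.normcM) mulrDl lerD//.
  rewrite -[M * K * _]mulrA; apply: ler_pM; rewrite ?normc_ge0//.
  exact: IH.
have -> : normc n.+1%:R = n.+1%:R.
  by rewrite -(rmorph_nat (real_complex R) n.+1) normc_real ger0_norm.
rewrite ler_wpM2r ?exprn_ge0 ?normc_ge0// ler_wpM2l// [M ^+ n.+3]exprS.
apply: ler_pM; rewrite ?normc_ge0 ?exprn_ge0 ?normc_ge0//.
by rewrite lerXn2r ?nnegrE ?normc_ge0.
Qed.

Variables (a b : R) (psi g : R -> Cplane R).
Hypotheses (ab : a < b) (cpsi : continuous psi) (cg : continuous g).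

Definition cauchy_transform (n : nat) (z : Cplane R) : Cplane R :=
  cint a b (fun t => psi t / (g t - z) ^+ n).

Lemma cauchy_kernel_continuous n z : (forall t, g t != z) ->
  continuous (fun t => psi t / (g t - z) ^+ n).
Proof.
move=> gz t; have gz0 : (g t - z) ^+ n != 0 by rewrite expf_neq0// subr_eq0.
have cp := cexp_continuous (n:=n) (csub_continuous (@cg t) (ccst_continuous z t)).
have ci := @cinv_continuous _ _ (fun t => (g t - z) ^+ n) t gz0 cp.
exact (cmul_continuous (@cpsi t) ci).
Qed.

Arguments cauchy_kernel_continuous n {z} _.

(** Differentiation under the integral sign: the remainder of the kernel is
    quadratic, uniformly along the curve. *)
Lemma cauchy_transform_deriv n z (del : R) : 0 < del ->
  (forall t, del <= normc (g t - z)) ->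
  cderiv (cauchy_transform n) z (n%:R * cauchy_transform n.+1 z).
Proof.
move=> del0 hz; pose d2 : R := del / 2.
have d20 : 0 < d2 by rewrite divr_gt0.
have [Mp Mp0 HMp] := continuous_bounded a b cpsi.
have M0 : 0 <= d2^-1 by rewrite invr_ge0 ltW.
have [K K0 HK] := inverse_power_taylor n M0.
apply: (@cderiv_quadratic _ _ _ _ (2 * (Mp * K) * (b - a)) d2) => // w wz.
have hw t : d2 <= normc (g t - w).
  have := ler_normcD (g t - w) (w - z); rewrite addrA subrK.
  by have := hz t; move: wz; rewrite /d2; lra.
have hz2 t : d2 <= normc (g t - z) by apply: le_trans (hz t); rewrite /d2; lra.
have ne v : (forall t, d2 <= normc (g t - v)) -> forall t, g t != v.
  by move=> hv t; rewrite -subr_eq0 -normc_gt0 (lt_le_trans d20).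
have nz := ne z hz2; have nw := ne w hw.
have cw := cauchy_kernel_continuous n nw.
have cz := cauchy_kernel_continuous n nz.
have cz1 := cauchy_kernel_continuous n.+1 nz.
have cs : continuous (fun t => n%:R * (w - z) * (psi t / (g t - z) ^+ n.+1)).
  by move=> t; exact (cmul_continuous (ccst_continuous (n%:R * (w - z)) t) (cz1 t)).
have cwz : continuous (fun t => psi t / (g t - w) ^+ n - psi t / (g t - z) ^+ n).
  by move=> t; exact (csub_continuous (cw t) (cz t)).
rewrite /cauchy_transform -(cintB a b cw cz) mulrAC -(cintMl _ a b cz1).
rewrite -(cintB a b cwz cs).
rewrite (_ : _ * normc (w - z) ^+ 2 = 2 * (Mp * K * normc (w - z) ^+ 2) * (b - a)); last by ring.
apply: (cint_le (ltW ab)).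
  by move=> t; exact (csub_continuous (cwz t) (cs t)).
move=> t tab; pose A := (g t - w)^-1; pose B := (g t - z)^-1.
have -> : psi t / (g t - w) ^+ n - psi t / (g t - z) ^+ n -
    n%:R * (w - z) * (psi t / (g t - z) ^+ n.+1) =
    psi t * (A ^+ n - B ^+ n - n%:R * B ^+ n.+1 * (w - z)).
  by rewrite /A /B !exprVn; ring.
rewrite Normc.normcM -[Mp * K * _]mulrA; apply: ler_pM; rewrite ?normc_ge0//; first exact: HMp.
apply: HK.
- by rewrite /A Normc.normcV lef_pV2 ?posrE ?(lt_le_trans d20).
- by rewrite /B Normc.normcV lef_pV2 ?posrE ?(lt_le_trans d20).
- rewrite /A /B; field.
  by rewrite !subr_eq0 nz nw.
Qed.
End CauchyTransform.
Arguments cauchy_kernel_continuous {R psi g} _ _ n {z} _.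

Record unit_contour (R : realType) (a b : R) (g g' : R -> Cplane R) : Prop :=
  UnitContour {
    contour_lt : a < b;
    contour_deriv : forall t, rderiv R g t (g' t);
    contour_speed : continuous g';
    contour_unit : forall t, Normc.normc (g t) = 1;
    contour_closed : g a = g b }.

Section Contour.
Variables (R : realType) (a b : R) (g g' : R -> Cplane R).
Hypothesis gc : unit_contour a b g g'.
Implicit Types (f F : Cplane R -> Cplane R) (z w : Cplane R) (rho : R).
Local Notation normc := (@Normc.normc R).

Let ab := contour_lt gc.
Let dg := contour_deriv gc.
Let cg' := contour_speed gc.
Let g1 := contour_unit gc.

Lemma contour_continuous : continuous g.
Proof. by move=> t; exact (has_deriv_continuous (@creal_continuous R) (dg t)). Qed.

Lemma contour_neq z t : normc z < 1 -> g t != z.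
Proof. by move=> z1; apply: contraTneq z1 => <-; rewrite g1 ltxx. Qed.

Lemma contour_gap z t : 1 - normc z <= normc (g t - z).
Proof. by have := ler_normcD (g t - z) z; rewrite subrK g1; lra. Qed.

Lemma holo_on_contour_continuous f rho : 1 < rho -> holo_disc rho f ->
  continuous (fun t => f (g t) * g' t).
Proof.
move=> rho1 hf t.
have [d fd] : exists d, cderiv f (g t) d by apply: hf; rewrite g1.
exact (cmul_continuous (cvg_comp _ _ (@contour_continuous t) (cderiv_continuous fd)) (@cg' t)).
Qed.

Lemma contour_primitive_int (F f : Cplane R -> Cplane R) :
  continuous (fun t => f (g t) * g' t) ->
  (forall t, cderiv F (g t) (f (g t))) -> cint a b (fun t => f (g t) * g' t) = 0.
Proof.
move=> cf dF; rewrite (cint_FTC2 (H := fun t => F (g t)) ab cf).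
  by rewrite (contour_closed gc) subrr.
by move=> t _; exact (has_deriv_comp (@creal_continuous R) (dF t) (dg t)).
Qed.

Lemma contour_holo_int f rho : 1 < rho -> holo_disc rho f ->
  cint a b (fun t => f (g t) * g' t) = 0.
Proof.
move=> rho1 hf; pose r := (1 + rho) / 2.
have [r1 rrho] : 1 < r /\ r < rho by rewrite /r; split; lra.
have [|F dF] := holo_primitive _ rrho hf; first by lra.
apply: contour_primitive_int (holo_on_contour_continuous rho1 hf) _ => t.
by apply: dF; rewrite g1.
Qed.

Definition winding z := cauchy_transform a b g' g 1 z.

(** The derivative of [winding] at [z] is the integral of [(w - z) ^- 2], which
    has the primitive [- (w - z)^-1]. *)
Lemma winding_const z w : normc z < 1 -> normc w < 1 -> winding z = winding w.
Proof.
move=> z1 w1; apply: (@cderiv0_const _ winding 1) => // u u1.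
have gap : 0 < 1 - normc u by rewrite subr_gt0.
have := cauchy_transform_deriv ab cg' contour_continuous 1 gap (contour_gap u).
rewrite (_ : 1%:R * _ = 0)//; rewrite mul1r /cauchy_transform.
have d t : cderiv (fun v => - (v - u)^-1) (g t) ((g t - u) ^- 2).
  have gu : g t - u != 0 by rewrite subr_eq0 contour_neq.
  have := has_derivN (has_derivV (@cid_continuous R)
    (has_derivB (has_deriv_iota (id : Cplane R -> _) (g t)) (has_deriv_cst id u (g t))) gu).
  by rewrite subr0 mulNr mul1r opprK.
have c := cauchy_kernel_continuous cg' contour_continuous 2 (fun t => contour_neq t u1).
rewrite -[RHS](contour_primitive_int (f := fun v => (v - u) ^- 2) _ d).
  by apply: eq_cint => t _; rewrite mulrC.
by under eq_fun do rewrite mulrC.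
Qed.

(** The difference quotient of [F] at [z] is holomorphic in the whole disc, so
    its integral over the closed curve vanishes. *)
Lemma cauchy_formula_primitive (F f : Cplane R -> Cplane R) rho z : 1 < rho ->
  (forall w, normc w < rho -> cderiv F w (f w)) -> holo_disc rho f ->
  normc z < 1 ->
  cauchy_transform a b (fun t => F (g t) * g' t) g 1 z = F z * winding z.
Proof.
move=> rho1 dF hf z1.
have hF : holo_disc rho F by move=> w wr; exists (f w); exact: dF.
have gz t := contour_neq t z1.
have cF := holo_on_contour_continuous rho1 hF.
have c1 := cauchy_kernel_continuous cF contour_continuous 1 gz.
have c2 := cauchy_kernel_continuous cg' contour_continuous 1 gz.
have hq := quotient_holo dF hf (lt_trans z1 rho1).
apply/eqP; rewrite -subr_eq0; apply/eqP.
rewrite -[RHS](contour_holo_int rho1 hq) /winding /cauchy_transform.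
rewrite -(cintMl (F z) a b c2).
have c3 : continuous (fun t => F z * (g' t / (g t - z) ^+ 1)).
  by move=> t; exact (cmul_continuous (ccst_continuous (F z) t) (c2 t)).
rewrite -(cintB a b c1 c3); apply: eq_cint => t _.
rewrite (negbTE (gz t)) expr1; field.
by rewrite subr_eq0.
Qed.
End Contour.

(** * The unit circle seen from an interior point *)

Section AngleContour.
Variables (R : realType) (eps : R).
Hypotheses (eps0 : 0 < eps).
Local Notation normc := (@Normc.normc R).

Definition cis (x : R) : Cplane R := cos x +i* sin x.
(** A point of the ellipse with semi-axes 1 and [eps]. *)
Definition ellipse (x : R) : Cplane R := cos x -i* (eps * sin x).
(** A point of the unit circle, whose argument [theta] is given by
    [tan (theta / 2) = eps * tan x]. *)
Definition angle_contour (x : R) : Cplane R := (ellipse x)^* / ellipse x.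
Definition angle_speed (x : R) : Cplane R := (2 * eps)*i / ellipse x ^+ 2.
Definition angle_pole : R := (1 - eps) / (1 + eps).

Lemma normc_cis x : normc (cis x) = 1.
Proof. by rewrite /Normc.normc /= cos2Dsin2 sqrtr1. Qed.

Lemma cis_neq0 x : cis x != 0.
Proof. by rewrite -normc_gt0 normc_cis. Qed.

Lemma ellipse_neq0 x : ellipse x != 0.
Proof.
apply/eqP => -[c0 /eqP]; rewrite oppr_eq0 mulf_eq0 gt_eqF//= => /eqP s0.
have := cos2Dsin2 x.
by rewrite c0 s0 expr0n addr0 => /esym/eqP; rewrite oner_eq0.
Qed.

Lemma rderiv_ellipse x : rderiv R ellipse x ((- sin x) -i* (eps * cos x)).
Proof.
have dc := rderiv_real (is_derive_cos x).
have ds := has_derivMl (@creal_continuous R) ((- eps)*i : Cplane R) (rderiv_real (is_derive_sin x)).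
have := has_derivD dc ds.
rewrite (_ : _ + _ = (- sin x) -i* (eps * cos x)); last first.
  by apply/eqP; rewrite eq_complex /=; apply/andP; split; apply/eqP; ring.
apply: has_deriv_ext => y.
by apply/eqP; rewrite eq_complex /=; apply/andP; split; apply/eqP; ring.
Qed.

Lemma rderiv_ellipseJ x : rderiv R (fun y => (ellipse y)^* : Cplane R) x ((- sin x) +i* (eps * cos x)).
Proof.
have dc := rderiv_real (is_derive_cos x).
have ds := has_derivMl (@creal_continuous R) (eps*i : Cplane R) (rderiv_real (is_derive_sin x)).
have := has_derivD dc ds.
rewrite (_ : _ + _ = (- sin x) +i* (eps * cos x)); last first.
  by apply/eqP; rewrite eq_complex /=; apply/andP; split; apply/eqP; ring.
apply: has_deriv_ext => y.
by apply/eqP; rewrite eq_complex /=; apply/andP; split; apply/eqP; ring.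
Qed.

Lemma ellipse_continuous : continuous ellipse.
Proof. by move=> x; exact (has_deriv_continuous (@creal_continuous R) (rderiv_ellipse x)). Qed.

Lemma angle_speed_continuous : continuous angle_speed.
Proof.
move=> x; have k2 : ellipse x ^+ 2 != 0 by rewrite expf_neq0// ellipse_neq0.
have cp := cexp_continuous (n:=2) (@ellipse_continuous x).
have ci := @cinv_continuous _ _ (fun t => ellipse t ^+ 2) x k2 cp.
exact (cmul_continuous (ccst_continuous ((2 * eps)*i : Cplane R) x) ci).
Qed.

Lemma rderiv_angle_contour x : rderiv R angle_contour x (angle_speed x).
Proof.
have cr := @creal_continuous R.
have := has_derivM cr (rderiv_ellipseJ x) (has_derivV cr (rderiv_ellipse x) (ellipse_neq0 x)).
rewrite (_ : _ + _ = angle_speed x)//; rewrite /angle_speed.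
have k0 := ellipse_neq0 x.
set k' := - sin x +i* (eps * cos x); set k'' := - sin x -i* (eps * cos x).
rewrite (_ : _ + _ = (k' * ellipse x - (ellipse x)^* * k'') / ellipse x ^+ 2); last by field.
congr (_ / _); apply/eqP; rewrite eq_complex /=; apply/andP; split; apply/eqP.
  by ring.
transitivity (2 * eps * (cos x ^+ 2 + sin x ^+ 2)); first by ring.
by rewrite cos2Dsin2 mulr1.
Qed.

Lemma normc_conj (z : Cplane R) : normc z^* = normc z.
Proof. by case: z => a b; rewrite /Normc.normc /= sqrrN. Qed.

Lemma normc_angle_contour x : normc (angle_contour x) = 1.
Proof.
rewrite Normc.normcM Normc.normcV normc_conj divff//.
by rewrite gt_eqF// normc_gt0 ellipse_neq0.
Qed.

Lemma angle_contour_pihalf : angle_contour (- (pi / 2)) = angle_contour (pi / 2).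
Proof.
have e0 : eps != 0 by rewrite gt_eqF.
have E (y : R) : y != 0 -> (0 -i* y)^* / (0 -i* y) = -1 :> Cplane R.
  move=> y0; have w0 : (0 -i* y) != 0 :> Cplane R.
    by apply/eqP => -[/eqP]; rewrite oppr_eq0 (negbTE y0).
  have -> : (0 -i* y)^* = - (0 -i* y) :> Cplane R.
    by apply/eqP; rewrite eq_complex /= oppr0 !eqxx.
  by rewrite mulNr divff.
by rewrite /angle_contour /ellipse sinN cosN cos_pihalf sin_pihalf !E// mulf_neq0// ?oppr_eq0 oner_neq0.
Qed.

Lemma pihalf_lt : - (pi / 2) < (pi / 2 : R).
Proof. by have := pi_gt0 R; lra. Qed.

Lemma angle_contourP :
  unit_contour (- (pi / 2)) (pi / 2) angle_contour angle_speed.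
Proof.
split; [exact: pihalf_lt|exact: rderiv_angle_contour|
  exact: angle_speed_continuous|exact: normc_angle_contour|
  exact: angle_contour_pihalf].
Qed.

Lemma angle_pole_lt1 : `|angle_pole| < 1.
Proof.
have e0 := eps0; have e1 : 0 < 1 + eps by lra.
rewrite /angle_pole normrM normfV (ger0_norm (ltW e1)) ltr_pdivrMr// mul1r.
by rewrite ltr_norml; apply/andP; split; lra.
Qed.

Lemma normc_angle_pole : normc angle_pole%:C < 1.
Proof. by rewrite normc_real angle_pole_lt1. Qed.

Lemma onem_angle_pole : 1 - angle_pole = 2 * eps / (1 + eps).
Proof. by have e0 := eps0; rewrite /angle_pole; field; lra. Qed.

(** The reason for this parametrization: as [eps] tends to 0, the vector from the
    pole to the point of the circle takes the direction [x], if [|x| < pi / 2]. *)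
Lemma angle_contour_sub x :
  angle_contour x - angle_pole%:C = (1 - angle_pole)%:C * (cis x / ellipse x).
Proof.
have k0 := ellipse_neq0 x; have e1 : 1 + eps != 0 by have := eps0; lra.
have e1C : (1 + eps)%:C != 0 :> Cplane R by rewrite eq_complex /= (negbTE e1).
rewrite onem_angle_pole /angle_pole /angle_contour.
have alg (p q m k kb c : Cplane R) : p != 0 -> k != 0 ->
    p * kb - q * k = m * c -> kb / k - q / p = m / p * (c / k).
  move=> p0 k0' h; rewrite (_ : _ - _ = (p * kb - q * k) / (p * k)).
    by rewrite h; field; rewrite p0 k0'.
  by field; rewrite p0 k0'.
rewrite (rmorphM _ (1 - eps)) (rmorphM _ (2 * eps)) fmorphV.
apply: alg => //.
by apply/eqP; rewrite eq_complex /=; apply/andP; split; apply/eqP; ring.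
Qed.

(** The distance [1 - angle_pole] from the pole to the circle factors out of the
    kernel; for [n > 0] what remains converges uniformly in [x] as [eps] tends
    to 0. *)
Lemma angle_kernel x n :
  angle_speed x / (angle_contour x - angle_pole%:C) ^+ n.+1 =
  (1 + eps)*i / (1 - angle_pole)%:C ^+ n * (ellipse x ^+ n / (ellipse x * cis x ^+ n.+1)).
Proof.
have k0 := ellipse_neq0 x; have e1 : 1 + eps != 0 by have := eps0; lra.
have c0 := cis_neq0 x.
have e1C : (1 + eps)%:C != 0 :> Cplane R by rewrite eq_complex /= (negbTE e1).
have p0 : (1 - angle_pole)%:C != 0 :> Cplane R.
  rewrite onem_angle_pole; apply/eqP => -[/eqP].
  by rewrite mulf_eq0 invr_eq0 (negbTE e1) orbF mulf_eq0 (gt_eqF eps0) orbF pnatr_eq0.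
rewrite angle_contour_sub /angle_speed.
have -> : (2 * eps)*i = (1 + eps)*i * (1 - angle_pole)%:C.
  by rewrite onem_angle_pole; apply/eqP; rewrite eq_complex /=; apply/andP; split; apply/eqP; field.
have alg (u p k c : Cplane R) : p != 0 -> k != 0 -> c != 0 ->
    u * p / k ^+ 2 / (p * (c / k)) ^+ n.+1 = u / p ^+ n * (k ^+ n / (k * c ^+ n.+1)).
  move=> hp hk hc.
  have -> : (p * (c / k)) ^+ n.+1 = p * p ^+ n * (c ^+ n.+1 / (k * k ^+ n)).
    by rewrite exprMn expr_div_n !exprS.
  have := expf_neq0 n.+1 hc; have := expf_neq0 n hk; have := expf_neq0 n hp.
  move: (p ^+ n) (k ^+ n) (c ^+ n.+1) => P K Q P0 K0 Q0.
  by field; rewrite hp hk P0 K0 Q0.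
exact: alg.
Qed.

End AngleContour.

Section AngleWinding.
Variables (R : realType) (eps : R).
Hypotheses (eps0 : 0 < eps).
Local Notation normc := (@Normc.normc R).

Let N (x : R) := cos x ^+ 2 + eps ^+ 2 * sin x ^+ 2.
Let P (x : R) := cos x ^+ 2 + eps * sin x ^+ 2.
Let Q (x : R) := (1 - eps) * (sin x * cos x) / P x.

Let pos (a x : R) : 0 < a -> 0 < cos x ^+ 2 + a * sin x ^+ 2.
Proof.
move=> a0; have c2 := sqr_ge0 (cos x); have s2 := sqr_ge0 (sin x).
by have := cos2Dsin2 x; nra.
Qed.

Let N0 x : 0 < N x. Proof. by apply: pos; rewrite exprn_gt0. Qed.
Let P0 x : 0 < P x. Proof. exact: pos. Qed.

Let NPQ x : N x = P x ^+ 2 + ((1 - eps) * (sin x * cos x)) ^+ 2.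
Proof.
transitivity (N x * (cos x ^+ 2 + sin x ^+ 2)); first by rewrite cos2Dsin2 mulr1.
by rewrite /N /P; ring.
Qed.

Let dln x : is_derive x (1 : R) (fun y => ln (N y))
  (- 2 * ((1 - eps) * (1 + eps) * (sin x * cos x) / N x)).
Proof.
have dN : is_derive x (1 : R) N (- 2 * (1 - eps) * (1 + eps) * (sin x * cos x)).
  by rewrite /N; apply: is_derive_eq; rewrite /GRing.scale/=; ring.
apply: (is_derive_eq (is_derive1_comp (is_derive1_ln (N0 x)) dN)).
by field; rewrite gt_eqF.
Qed.

Let datan x : is_derive x (1 : R) (fun y => 2 * y - atan (Q y))
  ((1 + eps) * P x / N x).
Proof.
have P0' : P x != 0 by rewrite gt_eqF.
have N0' : N x != 0 by rewrite gt_eqF.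
have dP : is_derive x (1 : R) P (- 2 * (1 - eps) * (sin x * cos x)).
  rewrite /P; apply: is_derive_eq; rewrite /GRing.scale/=; ring.
have dV := is_deriveV P0' dP.
have dT : is_derive x (1 : R) (fun y => (1 - eps) * (sin y * cos y))
    ((1 - eps) * (cos x ^+ 2 - sin x ^+ 2)).
  by apply: is_derive_eq; rewrite /GRing.scale/=; ring.
have dQ := is_deriveM dT dV.
have dA := is_derive1_comp (is_derive1_atan (Q x)) dQ.
have d2 : is_derive x (1 : R) (fun y : R => 2 * y) 2.
  by apply: is_derive_eq; rewrite /GRing.scale/=; ring.
apply: (is_derive_eq (is_deriveB d2 dA)).
rewrite /GRing.scale /=.
have -> : (1 + Q x ^+ 2)^-1 = P x ^+ 2 / N x.
  by rewrite NPQ /Q; field; rewrite -NPQ N0' P0'.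
rewrite (_ : P x ^+ 2 / N x * _ = (1 - eps) * ((cos x ^+ 2 - sin x ^+ 2) * P x +
   2 * (1 - eps) * (sin x * cos x) ^+ 2) / N x); last first.
  by field; rewrite N0' P0'.
apply: (mulIf N0'); rewrite mulrBl !divfK//.
transitivity (2 * N x * (cos x ^+ 2 + sin x ^+ 2) - (1 - eps) * ((cos x ^+ 2 - sin x ^+ 2) * P x +
   2 * (1 - eps) * (sin x * cos x) ^+ 2)); first by rewrite cos2Dsin2 mulr1.
transitivity ((1 + eps) * P x * (cos x ^+ 2 + sin x ^+ 2)); last by rewrite cos2Dsin2 mulr1.
by rewrite /N /P; ring.
Qed.

(** A logarithm of the vector from the pole to the contour, up to a constant. Its
    argument is also [x + atan (eps * tan x)], but the form with [Q] is smooth at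
    the endpoints, where the tangent is not. *)
Let H (x : R) : Cplane R :=
  (- 2^-1)%:C * (ln (N x))%:C + 'i * (2 * x - atan (Q x))%:C.

Let dH x : rderiv R H x
  (angle_speed eps x / (angle_contour eps x - (angle_pole eps)%:C) ^+ 1).
Proof.
have cr := @creal_continuous R.
have := has_derivD (has_derivMl cr (- 2^-1)%:C (rderiv_real (dln x)))
  (has_derivMl cr 'i (rderiv_real (datan x))).
rewrite (_ : _ + _ = angle_speed eps x / (angle_contour eps x - (angle_pole eps)%:C) ^+ 1)//.
rewrite (angle_kernel eps0) !expr0 divr1 expr1 mul1r.
have k0 := ellipse_neq0 eps0 x; have c0 := cis_neq0 x.
have N0' : N x != 0 by rewrite gt_eqF.
have kc0 : ellipse eps x * cis x != 0 by rewrite mulf_neq0.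
apply: (mulIf kc0); rewrite divfK//.
have -> : ellipse eps x * cis x = P x +i* ((1 - eps) * (sin x * cos x)).
  by apply/eqP; rewrite eq_complex /=; apply/andP; split; apply/eqP; rewrite /P; ring.
apply/eqP; rewrite eq_complex /=; apply/andP; split; apply/eqP; first by field.
rewrite [in RHS](_ : (1 + eps) = (1 + eps) * (N x / N x)); last by rewrite divff// mulr1.
by rewrite [in X in _ = _ * (X / _)]NPQ; field.
Qed.

Lemma angle_winding :
  winding (- (pi / 2)) (pi / 2) (angle_contour eps) (angle_speed eps)
    (angle_pole eps)%:C = (2 * pi)*i.
Proof.
have gc := angle_contourP eps0.
have c := cauchy_kernel_continuous (contour_speed gc) (contour_continuous gc) 1
  (fun t => contour_neq gc t (normc_angle_pole eps0)).
rewrite /winding /cauchy_transform (cint_FTC2 (pihalf_lt R) c (fun x _ => dH x)).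
rewrite /H /N /Q /P cosN sinN cos_pihalf sin_pihalf sqrrN mulr0 !mulr0 mul0r atan0 !subr0.
apply/eqP; rewrite eq_complex /=; apply/andP; split; apply/eqP.
  by ring.
by field.
Qed.
End AngleWinding.

(** * Analyticity of holomorphic functions *)

Section Regularity.
Variable R : realType.
Implicit Types (f : Cplane R -> Cplane R) (z w : Cplane R) (r rho : R).
Local Notation normc := (@Normc.normc R).

Lemma near_normc_lt z (r : R) : normc z < r -> \forall w \near z, normc w < r.
Proof.
move=> zr; apply/(nbhs_normcP z); exists (r - normc z); first by rewrite subr_gt0.
by move=> w wz; have := ler_normcD (w - z) z; rewrite subrK; lra.
Qed.

Let gc := @angle_contourP R 1 ltr01.

Lemma two_pi_i_neq0 : (2 * pi : R)*i != 0 :> Cplane R.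
Proof. by apply/eqP => -[/eqP]; rewrite mulf_eq0 pnatr_eq0/= gt_eqF// pi_gt0. Qed.

Lemma angle_winding_disc (eps : R) z : 0 < eps -> normc z < 1 ->
  winding (- (pi / 2)) (pi / 2) (angle_contour eps) (angle_speed eps) z = (2 * pi)*i.
Proof.
move=> eps0 z1; rewrite -(angle_winding eps0).
exact: (winding_const (angle_contourP eps0) z1 (normc_angle_pole eps0)).
Qed.

Section Transform.
Variables (eps : R) (psi : R -> Cplane R).
Hypotheses (eps0 : 0 < eps) (cpsi : continuous psi).
Let T := cauchy_transform (- (pi / 2)) (pi / 2) psi (angle_contour eps).

Definition cauchy_deriv n z : Cplane R := n`!%:R / (2 * pi)*i * T n.+1 z.

Lemma cauchy_derivP n z : normc z < 1 ->
  cderiv (cauchy_deriv n) z (cauchy_deriv n.+1 z).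
Proof.
move=> z1; have gap : 0 < 1 - normc z by rewrite subr_gt0.
have g := angle_contourP eps0.
have d := cauchy_transform_deriv (pihalf_lt R) cpsi (contour_continuous g) n.+1 gap
  (contour_gap g z).
have := has_derivMl (@cid_continuous R) (n`!%:R / (2 * pi)*i) d.
rewrite (_ : _ * _ = cauchy_deriv n.+1 z)//.
by rewrite /cauchy_deriv factS natrM /T; ring.
Qed.
End Transform.

Lemma cauchy_formula (eps : R) (F f : Cplane R -> Cplane R) rho z : 0 < eps -> 1 < rho ->
  (forall w, normc w < rho -> cderiv F w (f w)) -> holo_disc rho f ->
  normc z < 1 ->
  F z = cauchy_deriv eps (fun t => F (angle_contour eps t) * angle_speed eps t) 0 z.
Proof.
move=> eps0 rho1 dF hf z1.
rewrite /cauchy_deriv (cauchy_formula_primitive (angle_contourP eps0) rho1 dF hf z1).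
rewrite angle_winding_disc// fact0; field.
exact: two_pi_i_neq0.
Qed.

(** A primitive [F] of [f] satisfies Cauchy's formula, hence is a Cauchy
    transform and has derivatives of all orders, of which [f] is the first. *)
Lemma holo_derivative_unit f rho : 1 < rho -> holo_disc rho f ->
  exists f1, (forall z, normc z < 1 -> cderiv f z (f1 z)) /\ holo_disc 1 f1.
Proof.
move=> rho1 hf; pose r := (1 + rho) / 2.
have [r1 rrho] : 1 < r /\ r < rho by rewrite /r; split; lra.
have [|F dF] := holo_primitive _ rrho hf; first by lra.
have hfr : holo_disc r f by move=> z zr; apply: hf; exact: lt_trans rrho.
have hF : holo_disc r F by move=> z zr; exists (f z); exact: dF.
have cpsi := holo_on_contour_continuous gc r1 hF.
pose D := cauchy_deriv 1 (fun t => F (angle_contour 1 t) * angle_speed 1 t).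
have dD := cauchy_derivP ltr01 cpsi.
have fD z : normc z < 1 -> f z = D 1%N z.
  move=> z1; apply: (cderiv_unique (f := F) (dF z (lt_trans z1 r1))).
  apply: has_deriv_near (dD 0%N z z1).
  by apply: filterS (near_normc_lt z1) => w w1; rewrite -(cauchy_formula ltr01 r1 dF hfr w1).
exists (D 2%N); split => z z1; last by exists (D 3%N z); exact: dD.
apply: has_deriv_near (dD 1%N z z1).
by apply: filterS (near_normc_lt z1) => w w1; rewrite fD.
Qed.

Lemma cderiv_scale f (k c z d : Cplane R) : cderiv f (k * (z - c)) d ->
  cderiv (fun w => f (k * (w - c))) z (k * d).
Proof.
move=> fd; have cid := @cid_continuous R.
have d1 := has_derivMl cid k
  (has_derivB (has_deriv_iota (id : Cplane R -> _) z) (has_deriv_cst id c z)).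
have := @has_deriv_comp R _ id cid f (fun w => k * (w - c)) z _ d fd d1.
by rewrite subr0 mulr1 mulrC.
Qed.

Lemma holo_derivative f r rho : 0 < r -> r < rho -> holo_disc rho f ->
  exists f1, (forall z, normc z < r -> cderiv f z (f1 z)) /\ holo_disc r f1.
Proof.
move=> r0 rrho hf.
have rn : normc r%:C = r by rewrite normc_real ger0_norm// ltW.
have rC0 : r%:C != 0 :> Cplane R by rewrite -normc_gt0 rn.
have [||k1 [dk hk]] := @holo_derivative_unit (fun z => f (r%:C * (z - 0))) (rho / r).
- by rewrite ltr_pdivlMr// mul1r.
- move=> z zr; have [|d fd] := hf (r%:C * (z - 0)).
    by rewrite subr0 Normc.normcM rn mulrC -ltr_pdivlMr.
  by exists (r%:C * d); exact: cderiv_scale.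
have sc z : normc z < r -> normc (r%:C^-1 * (z - 0)) < 1.
  move=> zr; rewrite subr0 Normc.normcM Normc.normcV rn.
  by rewrite mulrC ltr_pdivrMr// mul1r.
exists (fun z => r%:C^-1 * k1 (r%:C^-1 * (z - 0))); split => z zr.
  have := cderiv_scale (dk _ (sc z zr)).
  by apply: has_deriv_ext => w; rewrite !subr0 mulrA divff// mul1r.
have [d fd] := hk _ (sc z zr).
exists (r%:C^-1 * (r%:C^-1 * d)).
exact (has_derivMl (@cid_continuous R) r%:C^-1 (cderiv_scale fd)).
Qed.

(** [f] is itself a primitive of a holomorphic function, its derivative. *)
Lemma holo_cauchy_formula (eps : R) f rho z : 0 < eps -> 1 < rho ->
  holo_disc rho f -> normc z < 1 ->
  f z = cauchy_deriv eps (fun t => f (angle_contour eps t) * angle_speed eps t) 0 z.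
Proof.
move=> eps0 rho1 hf z1; pose r := (1 + rho) / 2.
have [r1 rrho] : 1 < r /\ r < rho by rewrite /r; split; lra.
have [|f1 [df hf1]] := holo_derivative _ rrho hf; first by lra.
exact: (cauchy_formula eps0 r1 df hf1 z1).
Qed.

Lemma derive1n_tower (U : set (Cplane R)) f (D : nat -> Cplane R -> Cplane R) :
  (forall z, U z -> \forall w \near z, U w) ->
  (forall z, U z -> f z = D 0%N z) ->
  (forall n z, U z -> cderiv (D n) z (D n.+1 z)) ->
  forall n z, U z -> (f^`(n))%classic z = D n z.
Proof.
move=> oU fD dD; elim => [|n IH] z Uz; first by rewrite derive1n0 fD.
rewrite derive1nS derive1E.
have dn : cderiv ((f^`(n))%classic) z (D n.+1 z).
  apply: has_deriv_near (dD n z Uz).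
  by apply: filterS (oU z Uz) => w Uw; rewrite IH.
by have [_ ->] := cderiv_is_derive dn.
Qed.
End Regularity.

(** * The derivative estimate in the unit disc *)

Section Polar.
Variable R : realType.
Local Notation normc := (@Normc.normc R).
Implicit Types (x y : R) (z w : Cplane R).

Lemma cisD x y : cis (x + y) = cis x * cis y.
Proof.
apply/eqP; rewrite eq_complex /=; apply/andP; split; apply/eqP.
  by rewrite cosD.
by rewrite sinD addrC [sin x * _]mulrC mulrC addrC.
Qed.

Lemma cis0 : cis (0 : R) = 1.
Proof. by rewrite /cis cos0 sin0. Qed.

Lemma cisX x n : cis x ^+ n = cis (n%:R * x).
Proof.
elim: n => [|n IH]; first by rewrite expr0 mul0r cis0.
by rewrite exprS IH -cisD -natr1 mulrDl mul1r addrC.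
Qed.

Lemma cisV x : (cis x)^-1 = cis (- x).
Proof.
by apply: (mulfI (cis_neq0 x)); rewrite divff ?cis_neq0// -cisD subrr cis0.
Qed.

Lemma unit_cis w : normc w = 1 -> exists2 x : R, - pi <= x <= pi & w = cis x.
Proof.
case: w => a b; rewrite /Normc.normc /= => ab.
have ab1 : a ^+ 2 + b ^+ 2 = 1.
  by rewrite -[LHS]sqr_sqrtr ?addr_ge0 ?sqr_ge0// ab expr1n.
have a1 : -1 <= a <= 1.
  by have := sqr_ge0 b; rewrite -ler_norml => b2; rewrite -(@ler_pXn2r _ 2) ?nnegrE// real_normK ?num_real// expr1n; lra.
have sE : sin (acos a) = `|b|.
  by rewrite sin_acos// -ab1 addrC addKr sqrtr_sqr.
have cE : cos (acos a) = a by apply: acosK; rewrite in_itv/=.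
have [b0|b0] := leP 0 b.
  exists (acos a); last by rewrite /cis cE sE ger0_norm.
  by rewrite acos_lepi// (le_trans _ (acos_ge0 a1))// oppr_le0 pi_ge0.
exists (- acos a); last by rewrite /cis cosN sinN cE sE ltr0_norm// opprK.
by rewrite lerN2 acos_lepi//= (le_trans _ (pi_ge0 R))// oppr_le0 acos_ge0.
Qed.

(** Replaces the modulus of an integral by the real part of a rotated integral,
    which can be estimated under the integral sign. *)
Lemma polar z : exists x, normc z = complex.Re (cis x * z).
Proof.
have [->|z0] := eqVneq z 0; first by exists 0; rewrite mulr0 Normc.normc0.
have nz0 : normc z != 0 by rewrite gt_eqF// normc_gt0.
have [|x _ xE] := @unit_cis ((normc z)%:C / z).
  rewrite Normc.normcM Normc.normcV normc_real ger0_norm ?normc_ge0//.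
  by rewrite divff.
by exists x; rewrite -xE divfK.
Qed.
End Polar.

Section Conjugation.
Variable R : realType.
Implicit Types (z w : Cplane R).

Lemma cconjK z : z^*^* = z. Proof. exact: (@conjcK R). Qed.

Lemma cconjM z w : (z * w)^* = (z^* : Cplane R) * w^*.
Proof. exact: (rmorphM (@conjc R)). Qed.

Lemma cconjB z w : (z - w)^* = (z^* : Cplane R) - w^*.
Proof. exact: (rmorphB (@conjc R)). Qed.

Lemma cconjV z : (z^-1)^* = (z^* : Cplane R)^-1.
Proof. exact: (fmorphV (@conjc R)). Qed.

Lemma cconjX z n : (z ^+ n)^* = (z^* : Cplane R) ^+ n.
Proof. exact: (rmorphXn (@conjc R)). Qed.

Lemma cconj_real (x : R) : (x%:C)^* = x%:C :> Cplane R.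
Proof. exact: (@conjc_real R). Qed.

Lemma angle_contourJ (eps x : R) : 0 < eps ->
  (angle_contour eps x)^* = (angle_contour eps x)^-1.
Proof. by move=> e0; rewrite /angle_contour cconjM cconjV cconjK invfM invrK mulrC. Qed.

Lemma angle_speedJ (eps x : R) : 0 < eps ->
  (angle_speed eps x)^* = - (angle_speed eps x / angle_contour eps x ^+ 2).
Proof.
move=> e0; have k0 := ellipse_neq0 e0 x.
have kJ0 : (ellipse eps x)^* != 0 :> Cplane R.
  by rewrite -normc_gt0 normc_conj normc_gt0.
rewrite /angle_speed /angle_contour cconjM cconjV cconjX.
have -> : ((2 * eps)*i)^* = - (2 * eps)*i :> Cplane R.
  by apply/eqP; rewrite eq_complex /= oppr0 !eqxx.
by field; rewrite k0 kJ0.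
Qed.
End Conjugation.

Section EllipseBound.
Variables (R : realType) (eps : R).
Hypotheses (eps0 : 0 < eps) (eps1 : eps <= 1).
Local Notation normc := (@Normc.normc R).

Lemma ellipse_cosX_le (k : nat) x :
  normc (ellipse eps x ^+ k - (cos x)%:C ^+ k) <= k%:R * eps.
Proof.
have e0 := eps0; have e1 := eps1.
have s1 : `|sin x| <= 1 by rewrite ler_norml sin_geN1 sin_le1.
have c1 : normc (cos x)%:C <= 1 by rewrite normc_real ler_norml cos_geN1 cos_le1.
have k1 : normc (ellipse eps x) <= 1.
  rewrite /Normc.normc /= sqrrN -[leRHS]sqrtr1 ler_wsqrtr// -(cos2Dsin2 x) lerD2l.
  by rewrite exprMn ler_piMl ?sqr_ge0// expr_le1// ltW.
have d1 : normc (ellipse eps x - (cos x)%:C) <= eps.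
  rewrite (_ : _ - _ = - (eps * sin x)*i :> Cplane R); last first.
    by apply/eqP; rewrite eq_complex /=; apply/andP; split; apply/eqP; ring.
  rewrite normcN /Normc.normc /= expr0n add0r sqrtr_sqr normrM gtr0_norm//.
  by rewrite ler_piMr// ltW.
elim: k => [|k IH]; first by rewrite !expr0 subrr Normc.normc0 mul0r.
rewrite (_ : _ - _ = ellipse eps x * (ellipse eps x ^+ k - (cos x)%:C ^+ k) +
  (ellipse eps x - (cos x)%:C) * (cos x)%:C ^+ k); last by rewrite !exprS; ring.
rewrite (le_trans (ler_normcD _ _))// !Normc.normcM -natr1 mulrDl mul1r lerD//.
  by rewrite -[leRHS]mul1r ler_pM ?normc_ge0.
rewrite -[leRHS]mulr1 ler_pM ?normc_ge0// normcX exprn_ile1 ?normc_ge0//.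
Qed.
End EllipseBound.

Section DerivativeBound.
Variables (R : realType) (rho eps M : R) (k : nat) (f : Cplane R -> Cplane R).
Hypotheses (rho1 : 1 < rho) (hf : holo_disc rho f).
Hypotheses (eps0 : 0 < eps) (eps1 : eps <= 1).
Hypothesis fRe : forall t, `|complex.Re (f (angle_contour eps t))| <= 1.
Hypothesis KM : forall al : R, cos_integral k.+1 al <= M.
Local Notation normc := (@Normc.normc R).
Local Notation mu := (@lebesgue_measure R).
Local Notation g := (angle_contour eps).
Local Notation p := ((angle_pole eps)%:C : Cplane R).
Local Notation cintpi := (cint (- (pi / 2)) (pi / 2)).

Let gc := angle_contourP eps0.
Let gp t : g t != p. Proof. exact (contour_neq gc t (normc_angle_pole eps0)). Qed.
Let g0 t : g t != 0.
Proof. by rewrite -normc_gt0 normc_angle_contour. Qed.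

Let cfg : continuous (fun t => f (g t)).
Proof.
move=> t; have gr : normc (g t) < rho by rewrite normc_angle_contour.
have [d fd] := hf gr.
exact (cvg_comp _ _ (contour_continuous gc (x:=t)) (cderiv_continuous fd)).
Qed.

Let h (t : R) : Cplane R := angle_speed eps t / (g t - p) ^+ k.+2.

Let ch : continuous h.
Proof. exact (cauchy_kernel_continuous (contour_speed gc) (contour_continuous gc) k.+2 gp). Qed.

(** On the unit circle [conj w = 1/w], so the conjugate of this integral is, up to
    sign, the integral of a function holomorphic in a larger disc. *)
Let conj_int0 : cintpi (fun t => (f (g t))^* * h t) = 0.
Proof.
have p1 := angle_pole_lt1 eps0.
have p0 : 0 <= `|angle_pole eps| by [].
pose r := Num.min rho (2 / (1 + `|angle_pole eps|)).
have r1 : 1 < r by rewrite lt_min rho1 ltr_pdivlMr; lra.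
pose q w := f w * (w ^+ k / (1 - p * w) ^+ k.+2).
have hq : holo_disc r q.
  move=> w; rewrite lt_min => /andP[wrho w2].
  have cid := @cid_continuous R.
  have pw0 : 1 - p * w != 0.
    rewrite subr_eq0; apply/eqP => /(congr1 normc).
    rewrite Normc.normc1 Normc.normcM normc_real => E.
    move: w2; rewrite ltr_pdivlMr; last by lra.
    by have := normc_ge0 w; nra.
  have [d fd] := hf wrho.
  have d1 := has_derivB (has_deriv_cst id (1 : Cplane R) w)
    (has_derivMl cid p (has_deriv_iota (id : Cplane R -> _) w)).
  have d2 := has_derivX cid k.+2 d1.
  have d3 := has_derivV cid d2 (expf_neq0 k.+2 pw0).
  have d4 := has_derivX cid k (has_deriv_iota (id : Cplane R -> _) w).
  by eexists; exact (has_derivM cid fd (has_derivM cid d4 d3)).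
have := contour_holo_int gc r1 hq => q0.
have cq := holo_on_contour_continuous gc r1 hq.
have cfh : continuous (fun t => (f (g t))^* * h t).
  by move=> t; exact (cmul_continuous (continuous_conj (cfg (x:=t))) (ch (x:=t))).
apply: Normc.eq0_normc; rewrite -normc_conj -cint_conj; last exact cfh.
rewrite -[RHS](Normc.normc0 R); congr normc.
rewrite -oppr0 -q0 -cintN; last exact cq.
apply: eq_cint => t _.
have pg0 : 1 - p * g t != 0.
  rewrite subr_eq0; apply/eqP => /(congr1 normc).
  rewrite Normc.normc1 Normc.normcM normc_real normc_angle_contour// mulr1 => E.
  by move: p1; rewrite -E ltxx.
rewrite cconjM cconjK /q -mulrA -mulrN; congr (_ * _).
rewrite /h cconjM cconjV cconjX cconjB cconj_real angle_contourJ// angle_speedJ//.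
have := g0 t; move: (angle_speed eps t) (g t) pg0 => S G pG0 G0.
have -> : G^-1 - p = (1 - p * G) / G by field.
rewrite expr_div_n [G ^+ k.+2]exprS [G ^+ k.+1]exprS.
have := expf_neq0 k G0; have := expf_neq0 k.+2 pG0.
move: (G ^+ k) ((1 - p * G) ^+ k.+2) => A B B0 A0.
by field; rewrite G0 A0 B0.
Qed.

Let m (t : R) : Cplane R := ellipse eps t ^+ k / cis t ^+ k.+2.
Let v (t : R) : Cplane R := (complex.Re (f (g t)))%:C.
Let Z : Cplane R := cintpi (fun t => v t * m t).
Let u : Cplane R := (1 + eps)*i / (1 - angle_pole eps)%:C ^+ k.+1.

Let hE t : h t = u * m t.
Proof.
rewrite /h (angle_kernel eps0) /u /m; congr (_ * _).
have k0 := ellipse_neq0 eps0 t; have c0 := cis_neq0 t.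
by rewrite exprS; field; rewrite expf_neq0.
Qed.

Let cm : continuous m.
Proof.
move=> t; have c0 := expf_neq0 k.+2 (cis_neq0 t).
have cc : {for t, continuous (@cis R)}.
  by apply/continuous_complexP; split; [exact: continuous_cos|exact: continuous_sin].
have h1 := cexp_continuous (n:=k.+2) cc.
have h2 := @cinv_continuous R _ (fun t => cis t ^+ k.+2) t c0 h1.
exact (cmul_continuous (cexp_continuous (n:=k) (ellipse_continuous (x:=t))) h2).
Qed.

Let cRe : continuous (fun t => complex.Re (f (g t))).
Proof. exact (continuous_Re cfg). Qed.

Let cRm : continuous (fun t => v t * m t).
Proof. by move=> t; exact (cmul_continuous (continuous_real (cRe (x:=t))) (cm (x:=t))). Qed.

Let intE : cintpi (fun t => f (g t) * h t) = 2 * u * Z.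
Proof.
have c1 : continuous (fun t => f (g t) * h t).
  by move=> t; exact (cmul_continuous (cfg (x:=t)) (ch (x:=t))).
have c2 : continuous (fun t => (f (g t))^* * h t).
  by move=> t; exact (cmul_continuous (continuous_conj (cfg (x:=t))) (ch (x:=t))).
rewrite -[LHS]addr0 -conj_int0 -cintD; [|exact c1|exact c2].
rewrite /Z -cintMl; last exact cRm.
apply: eq_cint => t _; rewrite -mulrDl hE.
have -> : f (g t) + (f (g t))^* = 2 * v t.
  rewrite /v; case: (f (g t)) => a b; apply/eqP; rewrite eq_complex /=.
  by apply/andP; split; apply/eqP; ring.
by ring.
Qed.

Let rot_m (x t : R) : - (pi / 2) <= t <= pi / 2 ->
  `|complex.Re (cis x * m t)| <=
  `|cos (- x + k.+2%:R * t)| * cos t ^+ k + k%:R * eps.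
Proof.
move=> tp.
have -> : cis x * m t = (cos t ^+ k)%:C * cis (x - k.+2%:R * t) +
    (ellipse eps t ^+ k - (cos t)%:C ^+ k) * cis (x - k.+2%:R * t).
  by rewrite /m cisX cisV cisD rmorphXn /=; ring.
rewrite cReD (le_trans (ler_normD _ _))// lerD//.
  rewrite cReM /= mul0r subr0 normrM mulrC [X in _ * X]ger0_norm; last first.
    by rewrite exprn_ge0// cos_ge0_pihalf.
  by rewrite (_ : - x + _ = - (x - k.+2%:R * t)) ?cosN//; ring.
rewrite (le_trans (normc_Re _))// Normc.normcM normc_cis mulr1.
exact: ellipse_cosX_le.
Qed.

Let rot_cos_continuous (al : R) :
  continuous (fun t : R => `|cos (al + k.+2%:R * t)| * cos t ^+ k).
Proof.
move=> t; apply: cvgM.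
  apply: (continuous_comp _ (@norm_continuous R R _)).
  apply: (continuous_comp _ (@continuous_cos R _)).
  apply: cvgD; first exact: cvg_cst.
  by apply: cvgM; [exact: cvg_cst|exact: cvg_id].
exact (cvg_comp _ _ (@continuous_cos R t) (@exprn_continuous R k (cos t))).
Qed.

Let Zle : normc Z <= M + pi * (k%:R * eps).
Proof.
have [x ->] := polar Z.
have cx : continuous (fun t => cis x * (v t * m t)).
  by move=> t; exact (cmul_continuous (ccst_continuous (cis x) t) (cRm (x:=t))).
rewrite /Z -cintMl; last exact cRm.
have cB : continuous (fun t : R => `|cos (- x + k.+2%:R * t)| * cos t ^+ k + k%:R * eps).
  by move=> t; apply: cvgD; [exact: rot_cos_continuous|exact: cvg_cst].
rewrite /=.
apply: (@le_trans _ _ (\int[mu]_(t in `[- (pi / 2), pi / 2])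
   (`|cos (- x + k.+2%:R * t)| * cos t ^+ k + k%:R * eps))).
  apply: Rintegral_le; [exact: (continuous_Re cx)|exact: cB|].
  move=> t tp; rewrite mulrCA cReM /= mul0r subr0.
  apply: le_trans (rot_m x tp); rewrite (le_trans (ler_norm _))// normrM.
  by rewrite ler_piMl.
rewrite RintegralD//; last 2 first.
  by apply: continuous_integrable; exact: rot_cos_continuous.
  by apply: continuous_integrable; exact: cst_continuous.
rewrite Rintegral_const; last by rewrite ltW// pihalf_lt.
rewrite lerD//; first exact: (KM (- x)).
by rewrite le_eqVlt; apply/orP; left; apply/eqP; field.
Qed.

(** Adding the vanishing conjugate integral turns [f] into [2 * Re f] under the
    integral ([intE]). After a rotation the modulus is the integral of a real part
    and [|Re f| <= 1] applies pointwise, without loss of the constant. *)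
Lemma cauchy_deriv_bound :
  normc (cauchy_deriv eps (fun t => f (g t) * angle_speed eps t) k.+1 p) *
    (1 - angle_pole eps) ^+ k.+1 <=
  (k.+1)`!%:R / pi * (1 + eps) * (M + pi * (k%:R * eps)).
Proof.
have pi0 := pi_gt0 R.
have onem : 0 < 1 - angle_pole eps.
  by have := angle_pole_lt1 eps0; rewrite ltr_norml; lra.
rewrite /cauchy_deriv /cauchy_transform.
have -> : cintpi (fun t => f (g t) * angle_speed eps t / (g t - p) ^+ k.+2) = 2 * u * Z.
  by rewrite -intE; apply: eq_cint => t _; rewrite /h mulrA.
rewrite /u !(normcX, Normc.normcV, Normc.normcM) normc_real (gtr0_norm onem).
have nn (j : nat) : normc (j%:R : Cplane R) = j%:R.
  by rewrite -(rmorph_nat (real_complex R) j) normc_real ger0_norm.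
have ni (y : R) : 0 <= y -> normc (y*i : Cplane R) = y.
  by move=> y0; rewrite /Normc.normc /= expr0n add0r sqrtr_sqr ger0_norm.
have ni1 : normc ((1 + eps)*i : Cplane R) = 1 + eps by apply: ni; have := eps0; lra.
have ni2 : normc ((2 * pi)*i : Cplane R) = 2 * pi by apply: ni; lra.
rewrite !nn ni1 ni2.
have -> : (k.+1)`!%:R / (2 * pi) * (2 * ((1 + eps) / (1 - angle_pole eps) ^+ k.+1) * normc Z) *
    (1 - angle_pole eps) ^+ k.+1 = (k.+1)`!%:R / pi * (1 + eps) * normc Z.
  have pin0 : pi != 0 :> R by rewrite gt_eqF.
  have := expf_neq0 k.+1 (lt0r_neq0 onem); move: (_ ^+ k.+1) => a a0.
  move: (normc Z) (_`!%:R) (pi) pin0 => b c d d0.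
  by field; rewrite d0 a0.
have c0 : 0 <= (k.+1)`!%:R / pi * (1 + eps).
  by apply: mulr_ge0; [apply: divr_ge0; rewrite ?ler0n// ltW|have := eps0; lra].
exact: (ler_wpM2l c0 Zle).
Qed.
End DerivativeBound.

(** * Maximizing over the angle *)

Section Extremum.
Variable R : realType.
Local Notation mu := (@lebesgue_measure R).
Local Notation normc := (@Normc.normc R).
Implicit Types (al be x : R).

Lemma cos_lipschitz x y : `|cos x - cos y| <= `|x - y :> R|.
Proof.
wlog xy : x y / y <= x.
  by move=> H; have [/H//|/ltW/H] := leP y x; rewrite distrC [leRHS]distrC.
have [|c _ ->] := @MVT_segment R (@cos R) (fun t => - sin t) y x xy.
- by apply: continuous_subspaceT; exact: continuous_cos.
- rewrite normrM ler_piMl// normrN ler_norml.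
  by rewrite sin_geN1 sin_le1.
Qed.

Definition cos_kernel (s : nat) al x : R := `|cos (al + s.+1%:R * x)| * cos x ^+ s.-1.

Lemma cos_kernel_continuous s al : continuous (cos_kernel s al).
Proof.
move=> t; apply: cvgM.
  apply: (continuous_comp _ (@norm_continuous R R _)).
  apply: (continuous_comp _ (@continuous_cos R _)).
  apply: cvgD; first exact: cvg_cst.
  by apply: cvgM; [exact: cvg_cst|exact: cvg_id].
exact (cvg_comp _ _ (@continuous_cos R t) (@exprn_continuous R s.-1 (cos t))).
Qed.

Lemma cos_integralE s al : cos_integral s al =
  \int[mu]_(x in `[- (pi / 2), pi / 2]) cos_kernel s al x.
Proof. by []. Qed.

Lemma cos_integral_lipschitz s al be :
  cos_integral s al <= cos_integral s be + pi * `|al - be|.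
Proof.
have cB : continuous (fun x : R => cos_kernel s be x + `|al - be|).
  by move=> t; apply: cvgD; [exact: cos_kernel_continuous|exact: cvg_cst].
apply: (@le_trans _ _ (\int[mu]_(x in `[- (pi / 2), pi / 2])
   (cos_kernel s be x + `|al - be|))).
  apply: Rintegral_le; [exact: cos_kernel_continuous|exact: cB|].
  move=> x xp; have c0 := cos_ge0_pihalf xp.
  have c1 : cos x ^+ s.-1 <= 1 by rewrite exprn_ile1// cos_le1.
  have c2 : 0 <= cos x ^+ s.-1 by rewrite exprn_ge0.
  have := cos_lipschitz (al + s.+1%:R * x) (be + s.+1%:R * x).
  rewrite opprD addrACA subrr addr0 => h.
  have h2 := ler_dist_dist (cos (al + s.+1%:R * x)) (cos (be + s.+1%:R * x)).
  have h3 := ler_norm (`|cos (al + s.+1%:R * x)| - `|cos (be + s.+1%:R * x)|).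
  rewrite /cos_kernel -lerBlDl -mulrBl.
  have h4 : `|cos (al + s.+1%:R * x)| - `|cos (be + s.+1%:R * x)| <= `|al - be| by lra.
  apply: (@le_trans _ _ (`|al - be| * cos x ^+ s.-1)); first by rewrite ler_wpM2r.
  by rewrite ler_piMr.
rewrite RintegralD//; last 2 first.
  by apply: continuous_integrable; exact: cos_kernel_continuous.
  by apply: continuous_integrable; exact: cst_continuous.
rewrite Rintegral_const; last by rewrite ltW// pihalf_lt.
by rewrite cos_integralE lerD2l le_eqVlt; apply/orP; left; apply/eqP; field.
Qed.

Lemma cos_integral_continuous s : continuous (@cos_integral R s).
Proof.
move=> al; apply/cvgrPdist_lt => e e0.
have pi0 := pi_gt0 R.
apply/nbhs_ballP; exists (e / (pi + 1)); first by rewrite /= divr_gt0//; lra.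
move=> be; rewrite /ball/= ltr_pdivlMr; last by lra.
move=> ab; have h1 := cos_integral_lipschitz s al be.
have h2 := cos_integral_lipschitz s be al; rewrite distrC in h2.
have n0 := normr_ge0 (al - be).
by rewrite ltr_norml; apply/andP; split; nra.
Qed.

(** The integral depends only on [cis al], so [al] may be taken in [-pi, pi]. *)
Lemma cos_integral_max s : exists al, forall be,
  cos_integral s be <= cos_integral s al.
Proof.
have pp : - pi <= (pi : R) by have := pi_gt0 R; lra.
have [|al _ alP] := @EVT_max R (@cos_integral R s) (- pi) pi pp.
  by apply: continuous_subspaceT; exact: cos_integral_continuous.
exists al => be; have [be' bp E] := unit_cis (normc_cis be).
rewrite (_ : cos_integral s be = cos_integral s be'); first by apply: alP; rewrite in_itv.
rewrite !cos_integralE; apply: eq_Rintegral => x _; rewrite /cos_kernel !cosD.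
by case: E => -> ->.
Qed.

Lemma cos_integral_ge0 s al : 0 <= @cos_integral R s al.
Proof.
apply: Rintegral_ge0 => x /=; rewrite in_itv/= => xp.
by rewrite mulr_ge0// exprn_ge0// cos_ge0_pihalf.
Qed.

Lemma K_max s : exists2 al, forall be, cos_integral s be <= cos_integral s al &
  K_ R s = s`!%:R / pi * cos_integral s al.
Proof.
have [al alP] := cos_integral_max s; exists al => //.
rewrite /K_; congr (_ * _); apply/eqP; rewrite eq_le; apply/andP; split.
  by apply: ge_sup; [exists (cos_integral s al), al|move=> _ [be _ <-]].
by apply: ub_le_sup; [exists (cos_integral s al) => _ [be _ <-]|exists al].
Qed.
End Extremum.

(** * The upper bound along the radius *)

Section Disk.
Variable R : realType.
Local Notation normc := (@Normc.normc R).
Implicit Types (z w c zeta : Cplane R) (r : R).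

Lemma diskP c r z : disk c r z <-> normc (z - c) < r.
Proof.
by rewrite normcB -ltcR.
Qed.

Lemma disk_bdry c r zeta : 0 < r -> bdry (disk c r) zeta -> normc (zeta - c) = r.
Proof.
move=> r0 [cl nint]; apply/eqP; rewrite eq_le; apply/andP; split.
  rewrite leNgt; apply/negP => rz.
  have [|w [/diskP wr wz]] := cl [set w | normc (w - zeta) < normc (zeta - c) - r].
    by apply/(nbhs_normcP zeta); exists (normc (zeta - c) - r); rewrite ?subr_gt0.
  have := ler_normcD (zeta - w) (w - c); rewrite addrA subrK (normcB zeta w).
  by move: wz => /= wz; lra.
rewrite leNgt; apply/negP => zr; apply: nint.
apply/(nbhs_normcP zeta); exists (r - normc (zeta - c)); first by rewrite subr_gt0.
move=> w wz; apply/diskP.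
by have := ler_normcD (w - zeta) (zeta - c); rewrite addrA subrK; lra.
Qed.

Lemma class_cderiv (Omega : set (Cplane R)) f z :
  realpart_unit_class Omega f -> Omega z -> exists d, cderiv f z d.
Proof.
move=> [hf _] Oz; exists ('D_1 f z); apply: is_derive_cderiv.
by apply: derivableP; exact: hf.
Qed.

Lemma class_Re (Omega : set (Cplane R)) f z :
  realpart_unit_class Omega f -> Omega z -> `|complex.Re (f z)| <= 1.
Proof.
move=> [_ supf] Oz; rewrite -lee_fin; apply: le_trans supf.
by apply: ereal_sup_ubound; exists z.
Qed.
End Disk.

Section UpperBound.
Variables (R : realType) (k : nat) (M : R).
Hypothesis KM : forall al : R, cos_integral k.+1 al <= M.
Local Notation normc := (@Normc.normc R).
Let A : R := (k.+1)`!%:R / pi.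

Definition radius_majorant (tau : R) : R :=
  let e := (1 - tau) / (1 + tau) in
  (k.+1)`!%:R / pi * (1 + e) * (M + pi * (k%:R * e)).

Let M0 : 0 <= M.
Proof. exact: le_trans (cos_integral_ge0 _ 0) (KM 0). Qed.

Let A0 : 0 <= A.
Proof. by rewrite divr_ge0// pi_ge0. Qed.

(** Cauchy's formula uses [f] beyond the circle of integration, whence the
    smaller concentric disc of radius [rho * r]. *)
Lemma concentric_bound (Omega : set (Cplane R)) f (c zeta : Cplane R) (r tau rho : R) :
  0 < r -> disk c r `<=` Omega -> normc (zeta - c) = r ->
  realpart_unit_class Omega f -> 0 <= tau -> tau < rho -> rho < 1 ->
  normc ((f^`(k.+1))%classic (c + tau%:C * (zeta - c))) * (r * (rho - tau)) ^+ k.+1 <=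
  radius_majorant tau.
Proof.
move=> r0 DO zr fO tau0 taurho rho1.
rewrite /radius_majorant -/A; set e := (1 - tau) / (1 + tau).
have rho0 : 0 < rho := le_lt_trans tau0 taurho.
have pi0 := pi_gt0 R.
pose kp : Cplane R := rho%:C * (zeta - c).
have nkp : normc kp = rho * r by rewrite Normc.normcM normc_real gtr0_norm// zr.
have kp0 : kp != 0 by rewrite -normc_gt0 nkp mulr_gt0.
pose G w := f (kp * (w - (- c / kp))).
have Garg w : kp * (w - (- c / kp)) = kp * w + c by field.
have inD w : normc w < rho^-1 -> Omega (kp * (w - (- c / kp))).
  move=> wr; apply: DO; apply/diskP.
  rewrite Garg addrK Normc.normcM nkp mulrAC -[X in _ < X]mul1r ltr_pM2r//.
  by rewrite mulrC -ltr_pdivlMr// mul1r.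
have rho'1 : 1 < rho^-1 by rewrite invf_gt1.
have hG : holo_disc rho^-1 G.
  move=> w /inD Ow; have [d fd] := class_cderiv fO Ow.
  by exists (kp * d); exact: cderiv_scale.
pose ep := (rho - tau) / (rho + tau).
have rt : 0 < rho + tau by lra.
have ep0 : 0 < ep by rewrite divr_gt0// subr_gt0.
have ep1 : ep <= 1 by rewrite ler_pdivrMr// mul1r; lra.
have epe : ep <= e.
  rewrite /ep /e ler_pdivrMr// mulrAC ler_pdivlMr; last by lra.
  by nra.
have poleE : angle_pole ep = tau / rho.
  rewrite /angle_pole /ep; field.
  by apply/and3P; split; apply/eqP; lra.
have gRe t : `|complex.Re (G (angle_contour ep t))| <= 1.
  by apply: (class_Re fO); apply: inD; rewrite normc_angle_contour.
have B := cauchy_deriv_bound rho'1 hG ep0 ep1 gRe KM.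
pose psi t := G (angle_contour ep t) * angle_speed ep t.
have cpsi : continuous psi := holo_on_contour_continuous (angle_contourP ep0) rho'1 hG.
pose D := cauchy_deriv ep psi.
pose U : set (Cplane R) := [set v | normc (kp^-1 * (v - c)) < 1].
pose T n v := kp^-1 ^+ n * D n (kp^-1 * (v - c)).
have oU z : U z -> \forall w \near z, U w.
  move=> Uz; apply/(nbhs_normcP z).
  exists (normc kp * (1 - normc (kp^-1 * (z - c)))).
    by rewrite mulr_gt0 ?normc_gt0// subr_gt0.
  move=> w wz; rewrite /U /=.
  have -> : kp^-1 * (w - c) = kp^-1 * (w - z) + kp^-1 * (z - c) by ring.
  rewrite (le_lt_trans (ler_normcD _ _))// -ltrBrDr Normc.normcM Normc.normcV.
  by rewrite mulrC ltr_pdivrMr ?normc_gt0// mulrC.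
have fT z : U z -> f z = T 0%N z.
  move=> Uz; rewrite /T expr0 mul1r /D -(holo_cauchy_formula ep0 rho'1 hG Uz).
  by rewrite /G Garg; congr f; field.
have dT n z : U z -> cderiv (T n) z (T n.+1 z).
  move=> Uz; have := has_derivMl (@cid_continuous R) (kp^-1 ^+ n)
    (cderiv_scale (cauchy_derivP ep0 cpsi n Uz)).
  by rewrite mulrA -exprSr.
set z := c + _.
have zk : kp^-1 * (z - c) = (angle_pole ep)%:C.
  rewrite poleE /z addrC addKr /kp rmorphM fmorphV.
  have zc0 : zeta - c != 0 by rewrite -normc_gt0 zr.
  have rC0 : rho%:C != 0 :> Cplane R by rewrite -normc_gt0 normc_real gtr0_norm.
  by field; rewrite zc0 rC0.
have Uz : U z by rewrite /U /= zk; exact: normc_angle_pole.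
rewrite (derive1n_tower oU fT dT) // /T zk Normc.normcM normcX Normc.normcV nkp.
have -> : (rho * r)^-1 ^+ k.+1 * normc (D k.+1 (angle_pole ep)%:C) * (r * (rho - tau)) ^+ k.+1 =
    normc (D k.+1 (angle_pole ep)%:C) * (1 - angle_pole ep) ^+ k.+1.
  rewrite mulrAC -exprMn mulrC; congr (_ * _ ^+ _).
  by rewrite poleE; field; apply/andP; split; apply/eqP; lra.
apply: le_trans B _; rewrite -/A.
apply: ler_pM.
- by rewrite mulr_ge0//; lra.
- by rewrite addr_ge0// mulr_ge0 ?pi_ge0// mulr_ge0// ltW.
- by rewrite ler_wpM2l// lerD2l.
- by rewrite lerD2l ler_wpM2l ?pi_ge0// ler_wpM2l.
Qed.

(** The right-hand side does not depend on [rho], which may tend to 1. *)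
Lemma radius_bound (Omega : set (Cplane R)) f (c zeta : Cplane R) (r tau : R) :
  0 < r -> disk c r `<=` Omega -> normc (zeta - c) = r ->
  realpart_unit_class Omega f -> 0 <= tau -> tau < 1 ->
  normc ((f^`(k.+1))%classic (c + tau%:C * (zeta - c))) * (r * (1 - tau)) ^+ k.+1 <=
  radius_majorant tau.
Proof.
move=> r0 DO zr fO tau0 tau1; rewrite leNgt; apply/negP.
set X := normc _ => XB.
pose h y : R := X * (r * (y - tau)) ^+ k.+1.
have ch : {for 1, continuous h}.
  apply: cvgM; first exact: cvg_cst.
  apply: (@cvg_comp _ _ _ (fun y : R => r * (y - tau)) (fun y => y ^+ k.+1) _ _ _ _ (@exprn_continuous R k.+1 _)).
  apply: cvgM; first exact: cvg_cst.
  by apply: cvgB; [exact: cvg_id|exact: cvg_cst].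
have [d /= d0 hd] := (nbhs_ballP (1 : R) _).1 (cvgr_gt _ ch _ XB).
pose rho := Num.max ((tau + 1) / 2) (1 - d / 2).
have [rt r1 rd] : [/\ tau < rho, rho < 1 & 1 - d < rho].
  rewrite /rho !lt_max gt_max; split.
  - by apply/orP; left; lra.
  - by apply/andP; split; lra.
  - by apply/orP; right; lra.
have : ball (1 : R) d rho by rewrite /ball/= ltr_norml; apply/andP; split; lra.
move=> /hd; rewrite ltNge => /negP; apply.
exact: (concentric_bound r0 DO zr fO tau0 rt r1).
Qed.

End UpperBound.

(** [radius_majorant] exceeds its limit at 1 by at most a multiple of [1 - tau],
    with a factor [Q] that depends neither on [f] nor on the domain. *)
Lemma radial_boundP (R : realType) (k : nat) : radial_bound k.+1 (K_ R k.+1).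
Proof.
have [al alM KE] := K_max R k.+1; set M := cos_integral k.+1 al in alM KE.
move=> Omega zeta c r _ _ [r0 DO zb].
have zr := disk_bdry r0 zb; have pi0 := pi_gt0 R.
have M0 : 0 <= M := cos_integral_ge0 _ _.
pose A : R := (k.+1)`!%:R / pi.
have A0 : 0 <= A by rewrite divr_ge0// ltW.
pose Q := A * (M + 2 * pi * k%:R).
have Q0 : 0 <= Q by rewrite mulr_ge0// addr_ge0// mulr_ge0// mulr_ge0// ltW.
apply/lee_addgt0Pr => e e0.
rewrite /radial_limsup limf_esupE.
pose V : set (Cplane R) := [set z | (weighted_sup Omega zeta k.+1 z <= (K_ R k.+1)%:E + e%:E)%E].
apply: (@le_trans _ _ (ereal_sup (weighted_sup Omega zeta k.+1 @` V))); last first.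
  by apply: ge_ereal_sup => _ [z Vz <-].
apply: ereal_inf_lbound; exists V => //.
apply/(nbhs_normcP zeta); exists (r * (e / (Q + 1))).
  by rewrite mulr_gt0// divr_gt0//; lra.
move=> z zz [tau]; rewrite /= in_itv/= => /andP[tau0 tau1] zE.
rewrite /V /=; apply: ge_ereal_sup => _ [f fO <-].
rewrite -EFinD lee_fin.
have nz : Normc.normc (z - zeta) = r * (1 - tau).
  rewrite -zE (_ : _ - zeta = - ((1 - tau)%:C * (zeta - c))); last by rewrite rmorphB /=; ring.
  by rewrite normcN Normc.normcM normc_real zr mulrC ger0_norm// subr_ge0 ltW.
have t1 : 1 - tau < e / (Q + 1) by move: zz; rewrite nz ltr_pM2l.
have := radius_bound alM r0 DO zr fO tau0 tau1.
rewrite nz -zE mulrC => /le_trans; apply; rewrite /radius_majorant.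
set y := (1 - tau) / (1 + tau).
have y0 : 0 <= y by rewrite divr_ge0; lra.
have y1 : y <= 1 - tau by rewrite ler_pdivrMr; [nra|lra].
have yQ : y * Q <= e.
  have : (1 - tau) * (Q + 1) < e by rewrite -ltr_pdivlMr//; lra.
  by nra.
rewrite KE -/A -(mulrA A).
apply: (@le_trans _ _ (A * (M + y * (M + 2 * pi * k%:R)))).
  rewrite ler_wpM2l//.
  have kk : 0 <= pi * k%:R :> R by rewrite mulr_ge0// ltW.
  have yy : y * y <= y by rewrite ler_piMr//; lra.
  have yq : (pi * k%:R) * (y * y) <= (pi * k%:R) * y by rewrite ler_wpM2l.
  rewrite (_ : pi * (k%:R * y) = (pi * k%:R) * y); last by ring.
  rewrite (_ : 2 * pi * k%:R = 2 * (pi * k%:R)); last by ring.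
  by move: kk yq; move: (pi * k%:R) => q kk yq; lra.
by rewrite mulrDr lerD2l mulrCA.
Qed.

(** * Almost extremal functions in the half-plane *)

Definition half_plane (R : realType) : set (Cplane R) := [set z | 0 < complex.Re z].

Section HalfPlane.
Variable R : realType.
Local Notation normc := (@Normc.normc R).
Local Notation H := (@half_plane R).
Implicit Types (z w : Cplane R).

Lemma half_plane_near z : H z -> \forall w \near z, H w.
Proof.
move=> Hz; apply/(nbhs_normcP z); exists (complex.Re z) => // w wz.
have := normc_Re (w - z); rewrite cReD cReN /half_plane /= => h.
by have := le_lt_trans h wz; rewrite ltr_norml => /andP[+ _]; lra.
Qed.

Lemma half_plane_domain : domain H.
Proof.
split; last by exists 1; rewrite /half_plane /= ltr01.
  by rewrite openE => z; exact: half_plane_near.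
have -> : H = \bigcup_(z in H) (seg 1 z @` `[0, 1]%classic).
  apply/seteqP; split=> [z Hz|w [z Hz [t]]].
    by exists z => //; exists 1; rewrite ?seg1//= in_itv/= ler01 lexx.
  rewrite /= in_itv/= => /andP[t0 t1] <-; rewrite /half_plane /= in Hz *.
  by rewrite /seg cReD cReM cReD cReN /= mul0r subr0; nra.
apply: bigcup_connected.
  by exists 1 => z Hz; exists 0; rewrite ?seg0//= in_itv/= ler01 lexx.
move=> z Hz; apply: connected_continuous_connected; first exact: segment_connected.
by apply: continuous_subspaceT; exact: seg_continuous.
Qed.

Lemma near0_real (P : set (Cplane R)) : nbhs (0 : Cplane R) P ->
  exists2 d : R, 0 < d & forall x : R, `|x| < d -> P x%:C.
Proof.
move=> /(nbhs_normcP 0)[d d0 dP]; exists d => // x xd.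
by apply: dP; rewrite subr0 normc_real.
Qed.

Lemma half_plane_bdry : bdry H 0.
Proof.
split=> [P /near0_real[d d0 dP]|/near0_real[d d0 dP]].
  exists (d / 2)%:C; split; first by rewrite /half_plane /= divr_gt0.
  by apply: dP; rewrite gtr0_norm ?divr_gt0//; lra.
have : H (- (d / 2))%:C by apply: dP; rewrite normrN gtr0_norm ?divr_gt0//; lra.
by rewrite /half_plane /=; lra.
Qed.

Lemma half_plane_touched : touched_by_disk H 0 1 1.
Proof.
split; first exact: ltr01.
  move=> z /diskP z1; have := normc_Re (z - 1); rewrite cReD cReN /half_plane /=.
  by move=> /le_lt_trans/(_ z1); rewrite ltr_norml => /andP[+ _]; lra.
split=> [P /near0_real[d d0 dP]|].
  pose x := Num.min (d / 2) (1 / 2).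
  have [x0 xd x1] : [/\ 0 < x, x < d & x < 1].
    rewrite /x lt_min !gt_min; split; first by apply/andP; split; lra.
    - by apply/orP; left; lra.
    - by apply/orP; right; lra.
  exists x%:C; split; last by apply: dP; rewrite gtr0_norm.
  apply/diskP; rewrite -(rmorph1 (real_complex R)) -rmorphB normc_real.
  by rewrite ltr_norml; apply/andP; split; lra.
move=> /near0_real[d d0 dP].
have /diskP : disk 1 1 (0%:C : Cplane R) by apply: dP; rewrite normr0.
by rewrite rmorph0 sub0r normcN Normc.normc1 ltxx.
Qed.
End HalfPlane.

Section Extremal.
Variables (R : realType) (k : nat) (al : R) (N : R) (b : R).
Hypotheses (N0 : 0 < N) (b0 : 0 < b) (bpi : b < pi / 2).
Local Notation normc := (@Normc.normc R).
Local Notation mu := (@lebesgue_measure R).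
Local Notation H := (@half_plane R).

Definition ramp_sign (x : R) : R := Num.max (-1) (Num.min 1 (N * x)).

Lemma ramp_sign_le1 x : `|ramp_sign x| <= 1.
Proof.
rewrite /ramp_sign ler_norml le_max lexx /= ge_max ge_min lexx /= andbT.
by rewrite (le_trans (lerN10 R)).
Qed.

Lemma ramp_signM x : `|x| - N^-1 <= ramp_sign x * x.
Proof.
have Ni : 0 < N^-1 by rewrite invr_gt0.
have NN : N * N^-1 = 1 by rewrite divff// gt_eqF.
rewrite /ramp_sign; have [h1|h1] := leP (N * x) 1; last first.
  have x0 : 0 < x by rewrite -(pmulr_rgt0 _ N0); lra.
  by rewrite max_r; [rewrite gtr0_norm//; lra|lra].
have [h2|h2] := leP (-1) (N * x); last first.
  have x0 : x < 0 by rewrite -(pmulr_rlt0 _ N0); lra.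
  by rewrite ltr0_norm//; lra.
have xN : `|x| <= N^-1.
  rewrite ler_norml -(ler_pM2l N0) -[X in _ && X](ler_pM2l N0) mulrN NN.
  by rewrite h1 h2.
have : 0 <= N * x * x.
  by rewrite -mulrA; apply: mulr_ge0; [exact: ltW|rewrite -expr2; exact: sqr_ge0].
by move: xN; lra.
Qed.

Lemma ramp_sign_continuous : continuous ramp_sign.
Proof.
move=> x.
have c0 : {for x, continuous (fun=> N : R)} by exact: cst_continuous.
have c1 : {for x, continuous (fun=> -1 : R)} by exact: cst_continuous.
have c2 : {for x, continuous (fun=> 1 : R)} by exact: cst_continuous.
have c3 : {for x, continuous (id : R -> R)} by exact: cvg_id.
have c4 : {for x, continuous (fun y => N * y)} by exact (cvgM c0 c3).
exact (continuous_max c1 (continuous_min c2 c4)).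
Qed.

Let cosA (phi : R) : R := cos (al + k.+2%:R * phi).
Let u (phi : R) : R := ramp_sign (cosA phi).
Let Y : R := tan b.
Let psi (y : R) : Cplane R := (u (atan y))%:C.
Let g (y : R) : Cplane R := y*i.
Let CT := cauchy_transform (- Y) Y psi g.

(** The derivatives of the Schwarz integral in the right half-plane of the
    boundary values [u (atan y)] at the points [y*i], restricted to those points
    that are seen from 1 under an angle [atan y] between [- b] and [b]. With the
    exact sign in place of [ramp_sign] and [b = pi / 2] the derivative of order
    [k.+1] at 1 would have modulus at least
    [(k.+1)`! / pi * cos_integral k.+1 al]. *)
Definition extremal_deriv (n : nat) (z : Cplane R) : Cplane R :=
  ((- (n`!%:R / pi))%:C : Cplane R) * CT n.+1 z.

Let Y0 : 0 < Y.
Proof.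
have pi0 := pi_gt0 R; have b0' := b0; have bpi' := bpi.
have cb : 0 < cos b by rewrite cos_gt0_pihalf//; apply/andP; split; lra.
have sb : 0 < sin b by rewrite sin_gt0_pi//; apply/andP; split; lra.
by rewrite /Y /tan divr_gt0.
Qed.

Let atanY : atan Y = b.
Proof.
have pi0 := pi_gt0 R; have b0' := b0; have bpi' := bpi.
by rewrite /Y tanK// in_itv/=; apply/andP; split; lra.
Qed.

Let cosA_continuous : continuous cosA.
Proof.
move=> t; have c1 : {for t, continuous (fun t : R => al + k.+2%:R * t)}.
  apply: cvgD; first exact: cvg_cst.
  by apply: cvgM; [exact: cvg_cst|exact: cvg_id].
exact (cvg_comp _ _ c1 (@continuous_cos R _)).
Qed.

Let u_continuous : continuous u.
Proof. by move=> t; exact (cvg_comp _ _ (@cosA_continuous t) (@ramp_sign_continuous _)). Qed.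

Let ua_continuous : continuous (fun y => u (atan y)).
Proof. by move=> t; exact (cvg_comp _ _ (@continuous_atan R t) (@u_continuous _)). Qed.

Let psi_continuous : continuous psi.
Proof. by move=> y; exact (continuous_real (@ua_continuous y)). Qed.

Let g_continuous : continuous g.
Proof.
move=> y; apply/continuous_complexP; split => /=; first exact: cst_continuous.
exact: cvg_id.
Qed.

Let gap z t : complex.Re z <= normc (g t - z).
Proof.
have := normc_Re (g t - z); rewrite cReD cReN /g /= sub0r normrN.
by apply: le_trans; exact: ler_norm.
Qed.

Let YY : - Y < Y. Proof. by have := Y0; lra. Qed.

Lemma extremal_derivP n z : H z ->
  cderiv (extremal_deriv n) z (extremal_deriv n.+1 z).
Proof.
move=> Hz.
have d := cauchy_transform_deriv YY psi_continuous g_continuous n.+1 Hz (gap z).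
have := has_derivMl (@cid_continuous R) (- (n`!%:R / pi))%:C d.
rewrite (_ : _ * _ = extremal_deriv n.+1 z)//.
rewrite /extremal_deriv /CT factS natrM !rmorphN !rmorphM !rmorph_nat /=; ring.
Qed.

(** The Poisson kernel is positive and its mass is an increment of [atan] divided
    by [pi], hence at most 1. *)
Lemma extremal_Re z : H z -> `|complex.Re (extremal_deriv 0 z)| <= 1.
Proof.
move=> Hz; have pi0 := pi_gt0 R.
case: z Hz => x v Hz; have x0 : 0 < x := Hz.
pose q y := x / (x ^+ 2 + (y - v) ^+ 2).
have q2 y : 0 < x ^+ 2 + (y - v) ^+ 2 by rewrite ltr_pwDl ?exprn_gt0// sqr_ge0.
have q0 y : 0 <= q y by rewrite divr_ge0// ltW.
have dq y : is_derive y (1 : R) (fun y => atan ((y - v) / x)) (q y).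
  have dl : is_derive y (1 : R) (fun y => (y - v) / x) x^-1.
    by apply: is_derive_eq; rewrite /GRing.scale/=; ring.
  have dc := @is_derive1_comp R atan (fun y => (y - v) / x) y _ _ (is_derive1_atan _) dl.
  apply: (is_derive_eq dc).
  have xn0 : x != 0 by rewrite gt_eqF.
  have -> : 1 + ((y - v) / x) ^+ 2 = (x ^+ 2 + (y - v) ^+ 2) / x ^+ 2 by field.
  rewrite /q; have := lt0r_neq0 (q2 y); move: (x ^+ 2 + (y - v) ^+ 2) => m m0.
  by field; rewrite m0 xn0.
have cq : continuous q.
  move=> y; have c1 : {for y, continuous (fun y : R => x ^+ 2 + (y - v) ^+ 2)}.
    apply: cvgD; first exact: cvg_cst.
    have c2 : {for y, continuous (fun y : R => y - v)}.
      by apply: cvgB; [exact: cvg_id|exact: cvg_cst].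
    exact (cvg_comp _ _ c2 (@exprn_continuous R 2 _)).
  have c2 : {for y, continuous (fun=> x : R)} by exact: cst_continuous.
  have q2' := lt0r_neq0 (q2 y).
  exact (cvgM c2 (cvgV q2' c1)).
have gz t : g t != x +i* v.
  by rewrite -subr_eq0 -normc_gt0 (lt_le_trans x0)//; exact: (gap (x +i* v)).
have ck := cauchy_kernel_continuous psi_continuous g_continuous 1 gz.
rewrite /extremal_deriv cReM /= mul0r subr0 fact0.
have E y : complex.Re (psi y / (g y - (x +i* v)) ^+ 1) = - (u (atan y) * q y).
  rewrite expr1 cReM /psi /= mul0r subr0 /g /= sub0r.
  rewrite /q sqrrN; ring.
have cuq : continuous (fun y => u (atan y) * q y).
  by move=> y; exact (cvgM (@ua_continuous y) (cq y)).
rewrite normrM.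
have -> : \int[mu]_(y in `[- Y, Y]) complex.Re (psi y / (g y - (x +i* v)) ^+ 1) =
  \int[mu]_(y in `[- Y, Y]) - (u (atan y) * q y).
  by apply: eq_Rintegral => y _; rewrite E.
have -> : `|- (1%:R / pi)| = pi^-1 :> R by rewrite normrN mul1r ger0_norm// invr_ge0 ltW.
rewrite mulrC ler_pdivrMr// mul1r.
have cNuq : continuous (fun y => - (u (atan y) * q y)).
  by move=> y; exact (cvgN (cuq y)).
rewrite (le_trans (le_normr_Rintegral _ _))//; first exact: continuous_integrable.
apply: (@le_trans _ _ (\int[mu]_(y in `[- Y, Y]) q y)).
  apply: Rintegral_le; [|exact: cq|].
    by move=> y; exact (cvg_comp _ _ (cNuq y) (@norm_continuous R R _)).
  move=> y _; rewrite normrN normrM (ger0_norm (q0 y)) ler_piMl//.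
  exact: ramp_sign_le1.
rewrite (Rintegral_FTC2 YY cq (fun y _ => dq y)).
have := atan_ltpi2 ((Y - v) / x); have := atan_gtNpi2 ((- Y - v) / x).
lra.
Qed.

Let w (phi : R) : R := u phi * cosA phi * cos phi ^+ k.

Let w_continuous : continuous w.
Proof.
move=> t; have c1 : {for t, continuous (fun x => u x * cosA x)}.
  exact (cvgM (@u_continuous t) (@cosA_continuous t)).
have c2 : {for t, continuous (fun x : R => cos x ^+ k)}.
  exact (cvg_comp _ _ (@continuous_cos R t) (@exprn_continuous R k (cos t))).
exact (cvgM c1 c2).
Qed.

Let w_le1 phi : `|w phi| <= 1.
Proof.
have c1 (x : R) : `|cos x| <= 1 by rewrite ler_norml cos_geN1 cos_le1.
rewrite /w !normrM normrX.
have h1 : `|u phi| * `|cosA phi| <= 1.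
  by rewrite -[leRHS]mulr1 ler_pM//; [exact: ramp_sign_le1|exact: c1].
by rewrite -[leRHS]mulr1 ler_pM ?mulr_ge0 ?exprn_ge0// exprn_ile1.
Qed.

(** The kernel of [cos_integral] after the substitution [y = tan phi]. *)
Let extremal_kernel y :
  complex.Re (cis al * (psi y / (1 - g y) ^+ k.+2)) = w (atan y) / (1 + y ^+ 2).
Proof.
set phi := atan y; have yE : y = tan phi by rewrite atanK.
have c0 : 0 < cos phi by rewrite cos_gt0_pihalf// atan_gtNpi2 atan_ltpi2.
have c0' : cos phi != 0 by rewrite gt_eqF.
have cC0 : (cos phi)%:C != 0 :> Cplane R by rewrite -normc_gt0 normc_real gtr0_norm.
have -> : 1 - g y = cis (- phi) / (cos phi)%:C.
  apply: (mulIf cC0); rewrite divfK// /g yE /tan /cis cosN sinN.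
  by apply/eqP; rewrite eq_complex /=; apply/andP; split; apply/eqP; field.
rewrite expr_div_n invf_div cisX mulrN -cisV invrK.
have -> : cis al * (psi y * ((cos phi)%:C ^+ k.+2 * cis (k.+2%:R * phi))) =
    (u phi * cos phi ^+ k.+2)%:C * cis (al + k.+2%:R * phi).
  by rewrite cisD rmorphM rmorphXn /psi -/phi /=; ring.
rewrite cReM /= mul0r subr0 -/(cosA phi).
have c2 : cos phi ^+ 2 * (1 + y ^+ 2) = 1.
  rewrite yE /tan; transitivity (cos phi ^+ 2 + sin phi ^+ 2); first by field.
  exact: cos2Dsin2.
have y2 : 1 + y ^+ 2 != 0.
  by apply/eqP => y2; move: c2; rewrite y2 mulr0 => /esym/eqP; rewrite oner_eq0.
apply: (mulIf y2); rewrite divfK// /w !exprS.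
transitivity (u phi * cos phi ^+ k * cosA phi * (cos phi ^+ 2 * (1 + y ^+ 2))); first by ring.
by rewrite c2; ring.
Qed.

(** The ramp loses at most [N^-1] at each angle, the restriction to [[- b, b]] at
    most [pi / 2 - b] at each end. *)
Lemma extremal_deriv_ge :
  (k.+1)`!%:R / pi * (cos_integral k.+1 al - pi / N - 2 * (pi / 2 - b)) <=
  normc (extremal_deriv k.+1 1).
Proof.
have pi0 := pi_gt0 R.
have gz t : g t != 1.
  by rewrite -subr_eq0 -normc_gt0 (lt_le_trans (ltr01))//; exact: (gap 1).
rewrite /extremal_deriv Normc.normcM normc_real normrN ger0_norm; last first.
  by rewrite divr_ge0// ltW.
rewrite ler_wpM2l//; first by rewrite divr_ge0// ltW.
have gz1 t : (1 - g t) ^+ k.+2 != 0.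
  by rewrite expf_neq0// subr_eq0 eq_sym.
pose X := cint (- Y) Y (fun y => psi y / (1 - g y) ^+ k.+2).
have ck : continuous (fun y => psi y / (1 - g y) ^+ k.+2).
  move=> y; have h1 := cexp_continuous (n:=k.+2) (csub_continuous (ccst_continuous 1 y) (@g_continuous y)).
  exact (cmul_continuous (@psi_continuous y) (@cinv_continuous R _ (fun y => (1 - g y) ^+ k.+2) y (gz1 y) h1)).
have -> : normc (CT k.+2 1) = normc X.
  have -> : CT k.+2 1 = (-1) ^+ k.+2 * X.
    rewrite /X -cintMl; last exact ck.
    apply: eq_cint => t _.
    rewrite -[g t - 1]opprB -[- (1 - g t)]mulN1r exprMn invfM mulrCA.
    by rewrite invr_sign.
  by rewrite Normc.normcM normcX normcN Normc.normc1 expr1n mul1r.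
have -> : normc X = normc (cis al * X) by rewrite Normc.normcM normc_cis mul1r.
apply: le_trans (le_trans (ler_norm _) (normc_Re _)).
have cc : continuous (fun y => cis al * (psi y / (1 - g y) ^+ k.+2)).
  by move=> y; exact (cmul_continuous (ccst_continuous (cis al) y) (@ck y)).
rewrite /X -cintMl; last exact ck.
rewrite /=.
rewrite (_ : \int[mu]_(y in _) _ = \int[mu]_(y in `[- Y, Y]) (w (atan y) / (1 + y ^+ 2))); last first.
  by apply: eq_Rintegral => y _; rewrite extremal_kernel.
pose W x := \int[mu]_(t in `[- pi, x]) w t.
have dW x : - pi < x -> is_derive x (1 : R) W (w x).
  by move=> xp; exact: Rintegral_FTC1.
have cwa : continuous (fun y : R => w (atan y) / (1 + y ^+ 2)).
  move=> y; have y2 : 1 + y ^+ 2 != 0 by rewrite gt_eqF// ltr_pwDl// sqr_ge0.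
  have c1 : {for y, continuous (fun y : R => 1 + y ^+ 2)}.
    by apply: cvgD; [exact: cvg_cst|exact: exprn_continuous].
  have c2 : {for y, continuous (fun y : R => w (atan y))}.
    exact (cvg_comp _ _ (@continuous_atan R y) (@w_continuous _)).
  exact (cvgM c2 (cvgV y2 c1)).
have -> : \int[mu]_(y in `[- Y, Y]) (w (atan y) / (1 + y ^+ 2)) = W b - W (- b).
  have dWa (y : R) : - Y <= y <= Y ->
      is_derive y (1 : R) (fun y => W (atan y)) (w (atan y) / (1 + y ^+ 2)).
    move=> _; have ya : - pi < atan y by have := atan_gtNpi2 y; lra.
    exact: (is_derive1_comp (dW _ ya) (is_derive1_atan y)).
  by rewrite (Rintegral_FTC2 YY cwa dWa) atanN atanY.
have intW (a c : R) : - pi < a -> a < c -> \int[mu]_(t in `[a, c]) w t = W c - W a.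
  move=> ap ac; apply: (Rintegral_FTC2 ac w_continuous) => x /andP[ax _].
  by apply: dW; exact: lt_le_trans ax.
have tail (a c : R) : - pi < a -> a < c -> W c - W a <= c - a.
  move=> ap ac; rewrite -(intW _ _ ap ac) -[leRHS]mul1r -Rintegral_const; last exact: ltW.
  apply: Rintegral_le; [exact: w_continuous|exact: cst_continuous|].
  by move=> x _; exact: le_trans (ler_norm _) (w_le1 x).
have t1 := tail b (pi / 2) _ bpi; have t2 := tail (- (pi / 2)) (- b).
have full := intW (- (pi / 2)) (pi / 2).
have lower : cos_integral k.+1 al - pi / N <= \int[mu]_(t in `[- (pi / 2), pi / 2]) w t.
  have -> : cos_integral k.+1 al - pi / N =
      \int[mu]_(t in `[- (pi / 2), pi / 2]) (cos_kernel k.+1 al t - N^-1).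
    rewrite RintegralB//; last 2 first.
      by apply: continuous_integrable; exact: cos_kernel_continuous.
      by apply: continuous_integrable; exact: cst_continuous.
    rewrite Rintegral_const; last by rewrite ltW// pihalf_lt.
    by rewrite cos_integralE; congr (_ - _); field; rewrite gt_eqF.
  apply: Rintegral_le; [|exact: w_continuous|].
    by move=> t; apply: cvgB; [exact: cos_kernel_continuous|exact: cvg_cst].
  move=> t tp; have c0 : 0 <= cos t ^+ k by rewrite exprn_ge0// cos_ge0_pihalf.
  have c1 : cos t ^+ k <= 1 by rewrite exprn_ile1 ?cos_ge0_pihalf// cos_le1.
  have h := ramp_signM (cosA t).
  rewrite /cos_kernel /= -/(cosA t).
  apply: (@le_trans _ _ ((`|cosA t| - N^-1) * cos t ^+ k)).
    by rewrite mulrBl lerD2l lerN2 ler_piMr// invr_ge0 ltW.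
  by rewrite ler_wpM2r.
have p1 : - pi < b by have := b0; lra.
have p2 : - pi < - (pi / 2) :> R by lra.
have p3 : - (pi / 2) < - b by have := bpi; lra.
have p4 : - (pi / 2) < pi / 2 :> R by lra.
by have := t1 p1; have := t2 p2 p3; have := full p2 p4; lra.
Qed.
End Extremal.

(** * Sharpness *)

Section Sharpness.
Variable R : realType.
Local Notation normc := (@Normc.normc R).
Local Notation H := (@half_plane R).

(** Dilations preserve the half-plane and the bound on the real part, so a single
    function serves at all points of the radius. *)
Lemma weighted_sup_ge (D : nat -> Cplane R -> Cplane R) (n : nat) (x : R) :
  0 < x -> (forall n z, H z -> cderiv (D n) z (D n.+1 z)) ->
  (forall z, H z -> `|complex.Re (D 0%N z)| <= 1) ->
  ((normc (D n 1))%:E <= weighted_sup H 0%R n x%:C)%E.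
Proof.
move=> x0 dD D1; have xn0 : x != 0 by rewrite gt_eqF.
have xC0 : x%:C != 0 :> Cplane R by rewrite -normc_gt0 normc_real gtr0_norm.
have scaleH z : H z -> H (x%:C^-1 * (z - 0)).
  move=> Hz; rewrite subr0 -fmorphV /half_plane /= in Hz *.
  by rewrite cReM /= mul0r subr0 mulr_gt0// invr_gt0.
pose T m z := x%:C^-1 ^+ m * D m (x%:C^-1 * (z - 0)).
have dT m z : H z -> cderiv (T m) z (T m.+1 z).
  move=> Hz; have := has_derivMl (@cid_continuous R) (x%:C^-1 ^+ m)
    (cderiv_scale (dD m _ (scaleH z Hz))).
  by rewrite mulrA -exprSr.
have TO : realpart_unit_class H (T 0%N).
  split=> [z Hz|].
    by have [] := cderiv_is_derive (dT 0%N z Hz).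
  apply: ge_ereal_sup => _ [z Hz <-]; rewrite lee_fin /T expr0 mul1r.
  by apply: D1; exact: scaleH.
have Hx : H x%:C by [].
apply: ereal_sup_ubound; exists (T 0%N) => //; congr (_%:E).
rewrite (derive1n_tower (@half_plane_near R) (fun z _ => erefl) dT n Hx).
rewrite /T !subr0 mulVf// Normc.normcM normcX Normc.normcV normc_real gtr0_norm//.
by rewrite exprVn mulrA divff ?mul1r// expf_neq0.
Qed.

Lemma radial_limsup_ge (n : nat) (m : R) :
  (forall x : R, 0 < x -> (m%:E <= weighted_sup H 0%R n x%:C)%E) ->
  (m%:E <= radial_limsup H 0%R 1%R n)%E.
Proof.
move=> Hm; rewrite /radial_limsup limf_esupE.
apply: le_ereal_inf_tmp => _ [V FV <-].
have [d d0 dV] := near0_real FV.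
pose x := Num.min (d / 2) 1.
have [x0 xd x1] : [/\ 0 < x, x < d & x <= 1].
  rewrite /x lt_min gt_min ge_min lexx orbT; split=> //; first by rewrite divr_gt0/=.
  by apply/orP; left; lra.
apply: le_trans (Hm x x0) _; apply: ereal_sup_ubound; exists x%:C => //.
apply: dV; first by rewrite gtr0_norm.
exists (1 - x); first by rewrite /= in_itv/=; apply/andP; split; lra.
by rewrite rmorphB /= sub0r; ring.
Qed.

Lemma radial_bound_sharp (k : nat) (m : R) :
  m < K_ R k.+1 -> ~ radial_bound k.+1 m.
Proof.
have pi0 := pi_gt0 R; have [al alM ->] := K_max R k.+1.
set M := cos_integral _ _ in alM *; pose A : R := (k.+1)`!%:R / pi; rewrite -/A.
have A0 : 0 < A by rewrite divr_gt0// ltr0n fact_gt0.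
rewrite -ltr_pdivrMl// => mM bound.
pose del := M - A^-1 * m; have del0 : 0 < del by rewrite subr_gt0.
(* [N] and [b] make each of the two losses in [extremal_deriv_ge] at most
   [del / 4]. *)
pose N := 4 * pi / del; have N0 : 0 < N by rewrite divr_gt0// mulr_gt0.
pose b := Num.max (pi / 4) (pi / 2 - del / 8).
have [b0 bpi bd] : [/\ 0 < b, b < pi / 2 & pi / 2 - b <= del / 8].
  have : pi / 2 - del / 8 <= b by rewrite /b le_max lexx orbT.
  have : pi / 4 <= b by rewrite /b le_max lexx.
  move=> h1 h2; split; [lra| |lra].
  by rewrite /b gt_max; apply/andP; split; lra.
have piN : pi / N = del / 4.
  have alg (p d : R) : p != 0 -> d != 0 -> p / (4 * p / d) = d / 4.
    by move=> p0 d0; field; rewrite p0 d0.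
  by apply: alg; exact: lt0r_neq0.
have low := extremal_deriv_ge k al N0 b0 bpi.
have H1 := @radial_limsup_ge k.+1 (normc (extremal_deriv k al N b k.+1 1)).
have := bound H 0 1 1 (half_plane_domain R) (half_plane_bdry R) (half_plane_touched R).
apply/negP; rewrite -ltNge; apply: lt_le_trans (H1 _); last first.
  move=> x x0; apply: weighted_sup_ge => //.
  - by move=> n z; exact: extremal_derivP.
  - by move=> z; exact: extremal_Re.
rewrite lte_fin; apply: lt_le_trans low; rewrite -/A -/M piN.
rewrite -ltr_pdivrMl//; move: bd; rewrite /del in del0 *; lra.
Qed.
End Sharpness.

Theorem theorem4 (R : realType) (s : nat) (hs : (0 < s)%N) :
  [/\ exists alpha : R, forall beta : R,
        cos_integral s beta <= cos_integral s alpha,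
      radial_bound s (K_ R s)
    & forall k : R, k < K_ R s -> ~ radial_bound s k].
Proof.
case: s hs => // k _; split.
- exact: cos_integral_max.
- exact: radial_boundP.
- exact: radial_bound_sharp.
Qed.
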